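(* Let $(F_n)_{n\ge1}$ be i.i.d. random Lipschitz mappings of the proper metric space $\mathsf X$, fix a reference point $o\in\mathsf X$, and let $A_n=\mathfrak l(F_n)$ and $B_n=d(F_n(o),o)$. Suppose that $$\mathrm{Pr}[A_n>0]=1,\qquad \mathrm{Pr}[A_n<1]>0,\qquad \mathrm{Pr}[A_ny+B_n=y]<1\ \text{ for all } y\in\mathbb R,$$ and that, for some $\varepsilon>0$, $$\mathsf E(\log A_n)=0,\qquad \mathsf E(|\log A_n|^2)<\infty,\qquad \mathsf E\bigl((\log^+|B_n|)^{2+\varepsilon}\bigr)<\infty.$$ Let $\mathsf L$ be the smallest non-empty closed subset of $\mathsf X$ with the property that $f(\mathsf L)\subset\mathsf L$ for every $f\in\mathrm{supp}(\tilde\mu)$. Then the stochastic dynamical system $(X_n^x)$ is topologically recurrent on $\mathsf L$. Moreover, for every $x\in\mathsf X$ (and not just $x\in\mathsf L$) and every open set $U\subset\mathsf X$ that intersects $\mathsf L$, $$\mathrm{Pr}[X_n^x\in U\text{ for infinitely many }n]=1.$$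
   Context: $(\mathsf X,d)$ is a proper metric space (closed balls are compact); $\mathfrak G$ is the monoid of all continuous maps $\mathsf X\to\mathsf X$ with the topology of uniform convergence on compact sets. $(F_n)_{n\ge1}$ are i.i.d. $\mathfrak G$-valued random variables with common distribution $\tilde\mu$ (a regular probability measure on $\mathfrak G$), defined on a probability space $(\Omega,\mathfrak A,\mathrm{Pr})$, and almost surely Lipschitz; $\mathfrak l(f)$ denotes the Lipschitz constant of a Lipschitz map $f$. The stochastic dynamical system (SDS) is $X_0^x=x\in\mathsf X$, $X_n^x=F_n(X_{n-1}^x)$, $n\ge1$. Under the condition $\mathrm{Pr}[A_n>0]=1$, $\mathrm{Pr}[A_n<1]>0$, the smallest set $\mathsf L$ of the claim exists: there is a probability measure with the same support as $\tilde\mu$ which generates a strongly contractive recurrent SDS, and $\mathsf L$ is the limit set of that SDS. The SDS is topologically recurrent on a non-empty closed set $\mathsf L$ if for every open set $U$ that intersects $\mathsf L$ and every $x\in\mathsf L$, $\mathrm{Pr}[X_n^x\in U\text{ infinitely often}]=1$. *)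

(* Defs.v *)
From HB Require Import structures.
From mathcomp Require Import all_boot all_order all_algebra finmap.
From mathcomp Require Import all_classical all_reals all_analysis.

Set Implicit Arguments.
Unset Strict Implicit.
Unset Printing Implicit Defensive.

Import Order.TTheory GRing.Theory Num.Theory.
Import numFieldNormedType.Exports.

Local Open Scope classical_set_scope.
Local Open Scope ring_scope.

(* [closed_ball] is the closure of an open ball, which may be smaller than the
   metric closed ball, hence the explicit set. *)
Definition proper_space (R : realType) (X : metricType R) : Prop :=
  forall (x : X) (r : R), compact [set y | mdist x y <= r].

(* The monoid of continuous self-maps of [X], with the topology of uniform
   convergence on compact sets and the Borel sigma-algebra of that topology. *)
Definition selfmap (R : realType) (X : metricType R) : Type :=
  continuousType X X.

Definition selfmap_fun (R : realType) (X : metricType R) (f : selfmap X) :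
  {family compact, X -> X} := (f : continuousType X X) : X -> X.

HB.instance Definition _ (R : realType) (X : metricType R) :=
  Topological.copy (selfmap X) (initial_topology (@selfmap_fun R X)).

HB.instance Definition _ (R : realType) (X : metricType R) :=
  isPointed.Build (selfmap X) (idfun : continuousType X X).

HB.instance Definition _ (R : realType) (X : metricType R) :=
  Measurable.copy (selfmap X) (g_sigma_algebraType (@open (selfmap X))).

Definition is_lipschitz (R : realType) (X : metricType R) (f : X -> X) : Prop :=
  exists k : R, forall x y, mdist (f x) (f y) <= k * mdist x y.

(* The real [sup] is meaningful on sets bounded above only, i.e. for Lipschitz
   [f]; it is [0] on the empty set (one-point space) and, as a default value,
   when [f] is not Lipschitz. *)
Definition lipschitz_const (R : realType) (X : metricType R) (f : X -> X) : R :=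
  sup [set mdist (f p.1) (f p.2) / mdist p.1 p.2 |
        p in [set p : X * X | p.1 != p.2]].

(* [ln 0 = 0], so this is [0] at [t = 0]. *)
Definition log_plus (R : realType) (t : R) : R := Num.max 0 (ln t).

Definition regular_measure (R : realType) (X : metricType R)
    (mu : set (selfmap X) -> \bar R) : Prop :=
  forall B : set (selfmap X), measurable B ->
    mu B = ereal_inf [set mu V | V in [set V | open V /\ B `<=` V]] /\
    mu B = ereal_sup [set mu K | K in [set K | compact K /\ K `<=` B]].

Definition supp (R : realType) (X : metricType R)
    (mu : set (selfmap X) -> \bar R) : set (selfmap X) :=
  [set f | forall V : set (selfmap X), open V -> V f -> (0 < mu V)%E].

Definition mutually_independent (d d' : measure_display)
    (Omega : measurableType d) (T : measurableType d') (R : realType)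
    (P : probability Omega R) (F : nat -> {RV P >-> T}) : Prop :=
  forall (J : {fset nat}) (B : nat -> set T),
    (forall n, measurable (B n)) ->
    P (\bigcap_(n in [set` J]) (F n @^-1` B n)) =
    (\prod_(n <- J) P (F n @^-1` B n))%E.

Definition identically_distributed (d d' : measure_display)
    (Omega : measurableType d) (T : measurableType d') (R : realType)
    (P : probability Omega R) (F : nat -> {RV P >-> T})
    (mu : probability T R) : Prop :=
  forall n (B : set T), measurable B -> distribution P (F n) B = mu B.

(* [F n] is the map applied at time [n.+1]: the sequence is indexed from [0]. *)
Fixpoint sds (R : realType) (X : metricType R) (d : measure_display)
    (Omega : measurableType d) (P : probability Omega R)
    (F : nat -> {RV P >-> selfmap X}) (x : X) (n : nat) (w : Omega) : X :=
  if n is m.+1 then F m w (sds F x m w) else x.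

Definition infinitely_often (Omega X : Type) (Y : nat -> Omega -> X)
    (U : set X) : set Omega :=
  lim_sup_set (fun n => Y n @^-1` U).

Definition topologically_recurrent (R : realType) (X : metricType R)
    (d : measure_display) (Omega : measurableType d) (P : probability Omega R)
    (F : nat -> {RV P >-> selfmap X}) (L : set X) : Prop :=
  [/\ L !=set0, closed L &
      forall (U : set X) (x : X), open U -> U `&` L !=set0 -> L x ->
        P (infinitely_often (sds F x) U) = 1%E].

Definition invariant_closed (R : realType) (X : metricType R)
    (S : set (selfmap X)) (L : set X) : Prop :=
  [/\ L !=set0, closed L & forall f : selfmap X, S f -> f @` L `<=` L].

Definition smallest_invariant_closed (R : realType) (X : metricType R)
    (S : set (selfmap X)) (L : set X) : Prop :=
  invariant_closed S L /\ (forall M, invariant_closed S M -> L `<=` M).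

(* Main.v *)
Require Import Defs.
From HB Require Import structures.
From mathcomp Require Import all_boot all_order all_algebra finmap ring lra.
From mathcomp Require Import all_classical all_reals all_analysis measurable_realfun.

Set Implicit Arguments.
Unset Strict Implicit.
Unset Printing Implicit Defensive.

Import Order.TTheory GRing.Theory Num.Theory.
Import numFieldNormedType.Exports.

Local Open Scope classical_set_scope.
Local Open Scope ring_scope.

(** Write D_n = d(X_n, o), so that D_{n+1} <= A_{n+1} D_n + B_{n+1}.  The increments of
    log D_n have mean zero up to an error o(1 / log D_n) and a non-degenerate finite second
    moment, so by Lamperti's criterion log log D_n is a supermartingale outside a bounded set;
    by Fatou's lemma D_n does not tend to infinity, i.e. some ball around o is almost surely
    visited infinitely often.

    By regularity some f in the support of the law is a strict contraction; let x0 be its fixed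
    point.  Every non-empty closed invariant set contains x0, so L is the closure of the orbit
    of x0 under the support.  A finite composition of maps of the support (first many iterates
    of f, then a word leading from x0 into U) sends a whole ball into U, and this persists under
    perturbation of the maps; the conditional Borel-Cantelli lemma, applied to one letter of the
    word at a time, turns infinitely many visits to the ball into infinitely many visits to U. *)

(** * The topology of the self-maps *)

Section MetricFacts.
Context {R : realType} {X : metricType R}.
Implicit Types (x y z : X) (U : set X).

Definition cball x (r : R) : set X := [set y | mdist x y <= r].

Lemma open_mdistP U :
  open U <-> forall x, U x -> exists2 e : R, 0 < e & forall y, mdist x y < e -> U y.
Proof.
rewrite openE; split=> [oU x Ux|oU x /oU[e e0 eU]].
  have := oU x Ux; rewrite /interior -metricType_numDomainType.filter_from_mdist_nbhs.
  by move=> [e /= e0 eU]; exists e.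
by rewrite /interior -metricType_numDomainType.filter_from_mdist_nbhs; exists e.
Qed.

Lemma open_mdist_lt x (r : R) : open [set y | mdist x y < r].
Proof.
apply/open_mdistP => y /= xy; exists (r - mdist x y); first by rewrite subr_gt0.
by move=> z yz; rewrite (le_lt_trans (metric_triangle _ y _))// -ltrBrDl.
Qed.

Lemma open_mdist_gt x (r : R) : open [set y | r < mdist x y].
Proof.
apply/open_mdistP => y /= xy; exists (mdist x y - r); first by rewrite subr_gt0.
move=> z yz; have := metric_triangle x z y; rewrite (metric_sym z).
by rewrite ltrBrDl -ltrBrDr in yz => ?; rewrite (lt_le_trans yz)// lerBlDr.
Qed.

Lemma selfmap_mdist (f : selfmap X) x (e : R) : 0 < e ->
  exists2 r : R, 0 < r & forall y, mdist x y < r -> mdist (f x) (f y) < e.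
Proof.
move=> e0; have := @cts_fun _ _ f x.
move/metricType_numDomainType.cvgrPdist_lt/(_ _ e0).
rewrite /prop_near1 -metricType_numDomainType.filter_from_mdist_nbhs.
by move=> [r /= r0 rP]; exists r.
Qed.

End MetricFacts.

Section SelfmapTopology.
Context {R : realType} {X : metricType R}.
Implicit Types (f g : selfmap X) (x y : X) (U : set X).

(** The topology of uniform convergence on compact sets enters the rest of the proof only through
    these neighbourhoods. *)
Lemma open_selfmap_nbhs f (K : set X) (e : R) : compact K -> 0 < e ->
  exists V : set (selfmap X), [/\ open V, V f &
    forall g, V g -> forall x, K x -> mdist (f x) (g x) < e].
Proof.
move=> cK e0.
have := @fam_nbhs X X compact K [set p | mdist p.1 p.2 < e] (selfmap_fun f).
rewrite nbhsE => /(_ _ cK) []; last first.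
  move=> O [oO Of] OP.
  exists (@selfmap_fun R X @^-1` O); split => //.
    have /continuousP/(_ _ oO) := @initial_continuous _ _ (@selfmap_fun R X).
    by [].
  by move=> g Og x Kx; exact: (OP _ Og x Kx).
rewrite -entourage_ballE; exists e => //= -[a b] /=.
by rewrite ballEmdist.
Qed.

Lemma open_eval x U : open U -> open [set f : selfmap X | U (f x)].
Proof.
move=> /open_mdistP oU; rewrite openE => f /oU[e e0 eU].
have [V [oV Vf VP]] := open_selfmap_nbhs f (@compact_set1 _ x) e0.
by rewrite /interior nbhsE; exists V => // g /VP/(_ _ erefl)/eU.
Qed.

Lemma open_mdist_eval x y (c : R) : open [set f : selfmap X | c < mdist (f x) (f y)].
Proof.
rewrite openE => f /= cf.
have e0 : 0 < (mdist (f x) (f y) - c) / 2 by rewrite divr_gt0// subr_gt0.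
have [V [oV Vf VP]] := open_selfmap_nbhs f (@compact_set1 _ x) e0.
have [W [oW Wf WP]] := open_selfmap_nbhs f (@compact_set1 _ y) e0.
rewrite /interior nbhsE; exists (V `&` W); first by split => //; exact: openI.
move=> g [/VP/(_ _ erefl) gx /WP/(_ _ erefl) gy] /=.
have := metric_triangle (f x) (g x) (f y).
have := metric_triangle (g x) (g y) (f y); rewrite (metric_sym (g y)).
have := ltrD gx gy; rewrite -splitr => ? ? ?; rewrite ltNge; apply/negP => ?.
suff : mdist (f x) (f y) < mdist (f x) (f y) by rewrite ltxx.
lra.
Qed.

Lemma measurable_open_selfmap (V : set (selfmap X)) : open V -> measurable V.
Proof. by move=> oV; exact: sub_sigma_algebra. Qed.

End SelfmapTopology.

(** * Measurability of the Lipschitz constant *)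

Section Lipschitz.
Context {R : realType} {X : metricType R}.
Implicit Types (f : selfmap X) (x y : X).

Let ratios (f : X -> X) : set R :=
  [set mdist (f p.1) (f p.2) / mdist p.1 p.2 | p in [set p : X * X | p.1 != p.2]].

Lemma lipschitz_const_ge0 (f : X -> X) : 0 <= lipschitz_const f.
Proof.
rewrite /lipschitz_const -/(ratios f).
have [[[r rr] bS]|nS] := pselect (has_sup (ratios f)); last by rewrite sup_out.
apply: (@le_trans _ _ r); last exact: ub_le_sup.
by move: rr => [p _ <-]; rewrite divr_ge0 ?mdist_ge0.
Qed.

Lemma lipschitz_const_le (f : X -> X) (x y : X) : is_lipschitz f ->
  mdist (f x) (f y) <= lipschitz_const f * mdist x y.
Proof.
move=> [k fk]; have [->|xy] := eqVneq x y; first by rewrite !mdistxx mulr0.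
rewrite -ler_pdivrMr ?mdist_gt0// /lipschitz_const -/(ratios f).
apply: ub_le_sup; last by exists (x, y).
by exists k => _ [[a b] /= ab <-]; rewrite ler_pdivrMr ?mdist_gt0.
Qed.

(** For [c >= 0] the default value [0] of [sup] cannot exceed [c], so the left side forces [f] to be
    Lipschitz. *)
Lemma lt_lipschitz_constP (f : X -> X) (c : R) : 0 <= c ->
  c < lipschitz_const f <->
  is_lipschitz f /\ exists x y, c * mdist x y < mdist (f x) (f y).
Proof.
move=> c0; split=> [cf|[fl [x [y cxy]]]].
  have hS : has_sup (ratios f).
    apply: contrapT => nS; move: cf.
    by rewrite /lipschitz_const -/(ratios f) sup_out// ltNge c0.
  split.
    exists (lipschitz_const f) => x y.
    have [->|xy] := eqVneq x y; first by rewrite !mdistxx mulr0.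
    rewrite -ler_pdivrMr ?mdist_gt0//.
    by apply: ub_le_sup; [case: hS|exists (x, y)].
  have [_ [p pneq <-] cp] := sup_gt (hS.1) cf.
  by exists p.1, p.2; rewrite -ltr_pdivlMr ?mdist_gt0.
have xy : x != y by apply/eqP => xy; move: cxy; rewrite xy !mdistxx mulr0 ltxx.
have := lipschitz_const_le x y fl; move/(lt_le_trans cxy).
by rewrite ltr_pM2r// mdist_gt0.
Qed.

Lemma open_lt_lipschitz (c : R) :
  open [set f : selfmap X | exists x y, c * mdist x y < mdist (f x) (f y)].
Proof.
rewrite (_ : mkset _ = \bigcup_x \bigcup_y
    [set f : selfmap X | c * mdist x y < mdist (f x) (f y)]); last first.
  apply/seteqP; split=> f; first by move=> [x [y xy]]; exists x => //; exists y.
  by move=> [x _ [y _ xy]]; exists x, y.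
by apply: bigcup_open => x _; apply: bigcup_open => y _; exact: open_mdist_eval.
Qed.

(** A Lipschitz map has a natural number as a constant, and for a fixed constant the condition is
    closed. *)
Lemma measurable_is_lipschitz :
  measurable [set f : selfmap X | is_lipschitz f].
Proof.
rewrite (_ : mkset _ = \bigcup_(k : nat)
    ~` [set f : selfmap X | exists x y, k%:R * mdist x y < mdist (f x) (f y)]).
  apply: bigcup_measurable => k _; apply: measurableC.
  exact: measurable_open_selfmap (open_lt_lipschitz _).
apply/seteqP; split=> f /=.
  move=> [k fk]; exists (Num.truncn `|k|).+1 => //= -[x [y]].
  rewrite ltNge; apply/negP/negPn; apply: (le_trans (fk x y)).
  rewrite ler_wpM2r ?mdist_ge0//; apply: (le_trans (ler_norm _)).
  by rewrite ltW// truncnS_gt.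
move=> [k _ fk]; exists k%:R => x y; rewrite leNgt; apply/negP => kxy.
by apply: fk; exists x, y.
Qed.

Lemma measurable_lipschitz_const :
  measurable_fun setT (fun f : selfmap X => lipschitz_const f).
Proof.
apply: (measurability _ (RGenOInfty.measurableE R)) => // _ [_ [c ->] <-].
rewrite setTI; have [c0|c0] := ltP c 0.
  rewrite (_ : _ @^-1` _ = setT)//; apply/seteqP; split=> // f _ /=.
  by rewrite in_itv/= andbT (lt_le_trans c0)// lipschitz_const_ge0.
rewrite (_ : _ @^-1` _ = [set f : selfmap X | is_lipschitz f] `&`
    [set f : selfmap X | exists x y, c * mdist x y < mdist (f x) (f y)]).
  apply: measurableI; first exact: measurable_is_lipschitz.
  exact: measurable_open_selfmap (open_lt_lipschitz _).
apply/seteqP; split=> f /=; rewrite in_itv/= andbT.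
  by move/lt_lipschitz_constP => /(_ c0).
by move/(lt_lipschitz_constP _ c0).
Qed.

Lemma measurable_mdist_eval (x o : X) :
  measurable_fun setT (fun f : selfmap X => mdist (f x) o).
Proof.
apply: (measurability _ (RGenOInfty.measurableE R)) => // _ [_ [c ->] <-].
rewrite setTI; apply: measurable_open_selfmap.
rewrite (_ : _ @^-1` _ = [set f : selfmap X | [set y | c < mdist o y] (f x)]).
  exact: open_eval (open_mdist_gt _ _).
by apply/seteqP; split=> f /=; rewrite in_itv/= andbT metric_sym.
Qed.

End Lipschitz.

(** * Measurability of a random map at a random point *)

Section EvalMeasurable.
Context {R : realType} {X : metricType R}.

Lemma exists_invS_lt (e : R) : 0 < e -> exists k : nat, k.+1%:R^-1 < e.
Proof.
move=> e0; exists (Num.truncn e^-1); rewrite invf_plt ?posrE//.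
by rewrite truncnS_gt.
Qed.

(** [E n m] is a finite net of mesh [m.+1%:R^-1] in the compact ball of radius [n]; together the
    nets form a countable dense set. *)
Lemma proper_dense_fsets (hX : proper_space X) (o : X) :
  exists E : nat -> nat -> {fset X}, forall (x : X) (e : R), 0 < e ->
    exists n m, exists2 q, q \in E n m & mdist q x < e.
Proof.
pose Xp : ptopologicalType := HB.pack X (isPointed.Build X o).
have cov (n m : nat) : {E : {fset X} | forall x, mdist o x <= n%:R ->
    exists2 q, q \in E & mdist q x < m.+1%:R^-1}.
  apply: cid.
  have : @cover_compact Xp [set y | mdist o y <= n%:R].
    by rewrite -(@compact_cover Xp); exact: hX.
  move=> /(_ X setT (fun q => [set y | mdist q y < m.+1%:R^-1])) [].
  - by move=> q _; exact: open_mdist_lt.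
  - by move=> x _; exists x => //=; rewrite mdistxx invr_gt0.
  - by move=> E _ cE; exists E => x /cE[q /= qE qx]; exists q.
exists (fun n m => sval (cov n m)) => x e e0.
have [m me] := exists_invS_lt e0.
have := svalP (cov (Num.truncn (mdist o x)).+1 m) x.
move=> /(_ (ltW (truncnS_gt _)))[q qE qx].
by exists (Num.truncn (mdist o x)).+1, m; exists q => //; exact: lt_trans me.
Qed.

(** [T] is arbitrary so that the lemma also applies to the sigma-algebra of the past, where it makes
    the process adapted. *)
Lemma measurable_eval (hX : proper_space X) (d : measure_display)
    (T : measurableType d) (G : T -> selfmap X) (S : T -> X) :
  measurable_fun setT G ->
  (forall U, open U -> measurable (S @^-1` U)) ->
  forall U, open U -> measurable [set w | U (G w (S w))].
Proof.
move=> mG mS U oU.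
(* The nets need a base point of [X], which any point of [T] provides through [S]; an empty [T] is
   treated apart. *)
have [w0|/forallNP nT] := pselect (exists w : T, True); last first.
  rewrite (_ : mkset _ = set0)//; apply/seteqP; split => // w _.
  by case: (nT w).
have {}[E dE] : exists E : nat -> nat -> {fset X}, forall (x : X) (e : R), 0 < e ->
    exists n m, exists2 q, q \in E n m & mdist q x < e.
  by case: w0 => w _; exact: proper_dense_fsets (S w).
pose inU (k : nat) : set X := [set z | forall y, mdist z y < k.+1%:R^-1 -> U y].
have oinU k : open (~` inU k).
  rewrite (_ : ~` _ = \bigcup_(y in ~` U) [set z | mdist y z < k.+1%:R^-1]).
    by apply: bigcup_open => y _; exact: open_mdist_lt.
  apply/seteqP; split=> z /=.
    move=> /existsNP[y /not_implyP[zy nUy]]; exists y => //=.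
    by rewrite metric_sym.
  by move=> [y nUy yz] /(_ y); rewrite metric_sym => /(_ yz).
(* By continuity [G w (S w)] is in [U] iff its values at dense points close to [S w] stay
   uniformly inside [U], which is a countable condition. *)
rewrite (_ : mkset _ = \bigcup_k \bigcup_m \bigcap_i \bigcap_j
    \bigcap_(q in [set` E i j])
      (~` (S @^-1` [set y | mdist q y < m.+1%:R^-1]) `|`
       ~` (G @^-1` [set f | (~` inU k) (f q)]))).
  apply: bigcup_measurable => k _; apply: bigcup_measurable => m _.
  apply: bigcapT_measurable => i; apply: bigcapT_measurable => j.
  apply: fin_bigcap_measurable => // q _.
  apply: measurableU; apply: measurableC.
    by apply: mS; exact: open_mdist_lt.
  rewrite -(setTI (G @^-1` _)); apply: mG => //.
  by apply: measurable_open_selfmap; exact: open_eval.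
apply/seteqP; split=> w /=.
  move=> Uw; have /open_mdistP/(_ _ Uw)[e e0 eU] := oU.
  have e20 : 0 < e / 2 by rewrite divr_gt0.
  have [k ke] := exists_invS_lt e20.
  have [r r0 rP] := selfmap_mdist (G w) (S w) e20.
  have [m mr] := exists_invS_lt r0.
  exists k => //; exists m => // i _ j _ q qE.
  have [qw|?] := pselect (mdist q (S w) < m.+1%:R^-1); last by left.
  right=> nin; apply: nin => y qy.
  apply: eU; rewrite (splitr e) (le_lt_trans (metric_triangle _ (G w q) _))//.
  rewrite ltrD ?(lt_trans qy)// rP//.
  by rewrite metric_sym (lt_trans qw).
move=> [k _ [m _ H]].
have k0 : (0 : R) < k.+1%:R^-1 by rewrite invr_gt0.
have m0 : (0 : R) < m.+1%:R^-1 by rewrite invr_gt0.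
have [r r0 rP] := selfmap_mdist (G w) (S w) k0.
(* One net point [q] suffices for the converse: it is close enough to [S w] for the countable
   condition to apply and for [G w q] to be within the margin of [G w (S w)]. *)
have [|i [j [q qE qw]]] := dE (S w) (Num.min r m.+1%:R^-1).
  by rewrite lt_min r0.
move: qw; rewrite lt_min => /andP[qr qm].
have := H i I j I q qE; case => // /contrapT; apply.
by rewrite metric_sym rP// metric_sym.
Qed.

End EvalMeasurable.

(** * The past of an i.i.d. sequence *)

Section Independence.
Context {d d' : measure_display} {Omega : measurableType d}
  {T : measurableType d'} {R : realType} {P : probability Omega R}.
Context (F : nat -> {RV P >-> T}) (mu : probability T R).
Context (hdist : identically_distributed F mu) (hindep : mutually_independent F).
Local Open Scope ereal_scope.

(** Product events rather than single preimages, so that the family is stable under intersection. *)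
Definition cylinders (n : nat) : set (set Omega) :=
  [set C | exists2 B : nat -> set T, (forall k, measurable (B k)) &
    C = \bigcap_(k in `I_n) (F k @^-1` B k)].

(** Generated by [F 0], ..., [F (n - 1)]: it determines the process at time [n] and is independent
    of [F n], the map applied next. *)
Definition past (n : nat) : set (set Omega) := <<s cylinders n >>.

Lemma cylinders_setI n : setI_closed (cylinders n).
Proof.
move=> _ _ [B mB ->] [C mC ->]; exists (fun k => B k `&` C k).
  by move=> k; exact: measurableI.
apply/seteqP; split=> w /=; first by move=> [Bw Cw] k kn; split; [exact: Bw|exact: Cw].
by move=> BCw; split=> k kn; have [] := BCw k kn.
Qed.

Lemma past_measurable n : past n `<=` measurable.
Proof.
apply: smallest_sub; first exact: sigma_algebra_measurable.
move=> _ [B mB ->]; apply: bigcap_measurableType => k _.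
exact: measurable_funPTI.
Qed.

Lemma past_le n m : (n <= m)%N -> past n `<=` past m.
Proof.
move=> nm; apply: sub_sigma_algebra2 => _ [B mB ->].
exists (fun k => if (k < n)%N then B k else setT).
  by move=> k; case: ifP.
apply/seteqP; split=> w /= Bw k.
  by move=> _; case: ifP => // kn; exact: Bw.
by move=> kn; have := Bw k (leq_trans kn nm); rewrite kn.
Qed.

Lemma past_preimage n k (B : set T) :
  (k < n)%N -> measurable B -> past n (F k @^-1` B).
Proof.
move=> kn mB; apply: sub_sigma_algebra.
exists (fun j => if j == k then B else setT); first by move=> j; case: ifP.
apply/seteqP; split=> w /= Bw; last by have := Bw k kn; rewrite eqxx.
by move=> j _; case: eqP => [->|].
Qed.

(** Dynkin's argument: the events obeying the product rule form a lambda-system that contains the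
    cylinders. *)
Lemma past_indep n (C : set Omega) (V : set T) : past n C -> measurable V ->
  P (C `&` F n @^-1` V) = P C * mu V.
Proof.
move=> + mV.
pose H := [set C | measurable C /\ P (C `&` F n @^-1` V) = P C * mu V].
have mFV : measurable (F n @^-1` V) by exact: measurable_funPTI.
have PF k (B : set T) : measurable B -> P (F k @^-1` B) = mu B.
  by move=> mB; rewrite -(hdist k mB).
suff : past n `<=` H by move=> /[apply] -[].
apply: lambda_system_subset => //; first exact: cylinders_setI.
- apply/dynkin_lambda_system; split.
  + by split => //; rewrite setTI PF// probability_setT mul1e.
  + move=> B [mB BV]; split; first exact: measurableC.
    have finP A : measurable A -> P A \is a fin_num by move=> ?; exact: fin_num_measure.
    have E : P (F n @^-1` V `\` B) = P (F n @^-1` V) - P (F n @^-1` V `&` B).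
      by apply: measureD => //; rewrite ltey_eq finP.
    rewrite setIC -setDE E [X in _ - P X]setIC BV PF// probability_setC//.
    by rewrite muleBl ?mul1e ?fin_num_adde_defr ?fin_num_measure ?finP.
  + move=> B tB BH; have mB k : measurable (B k) by have [] := BH k.
    split; first exact: bigcup_measurable.
    have sumP (A : nat -> set Omega) : (forall k, measurable (A k)) ->
        trivIset setT A -> P (\bigcup_k A k) = \sum_(k <oo) P (A k).
      move=> mA tA; rewrite measure_bigcup//.
      by apply: eq_eseriesl => k; rewrite in_setT.
    rewrite setI_bigcupl !sumP//; last 2 first.
      by move=> i; exact: measurableI.
      exact: trivIset_setIr.
    under eq_eseriesr do rewrite (BH _).2 muleC.
    have -> : mu V = (fine (mu V))%:E by rewrite fineK// fin_num_measure.
    rewrite nneseriesZl; last by move=> i _; exact: measure_ge0.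
    exact: muleC.
- move=> _ [B mB ->]; split.
    apply: bigcap_measurableType => k _; exact: measurable_funPTI.
  (* With [V] as its last factor the intersection is a cylinder of length [n.+1], to which mutual
     independence applies. *)
  pose B' k := if (k == n)%N then V else B k.
  have mB' k : measurable (B' k) by rewrite /B'; case: ifP.
  have E m (D : nat -> set T) :
      \bigcap_(k in [set` [fset (i : nat) | i in iota 0 m]%fset]) (F k @^-1` D k) =
      \bigcap_(k in `I_m) (F k @^-1` D k).
    by congr bigcap; apply/seteqP; split=> k /=; rewrite in_fset mem_iota.
  have pr m (D : nat -> set T) : (forall k, measurable (D k)) ->
      P (\bigcap_(k in `I_m) (F k @^-1` D k)) = \prod_(k < m) mu (D k).
    move=> mD; rewrite -E hindep//.
    rewrite (perm_big (iota 0 m)) /=; last first.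
      apply: uniq_perm; rewrite ?fset_uniq ?iota_uniq// => k.
      by rewrite in_fset.
    rewrite -{1}[m]subn0 -/(index_iota 0 m) big_mkord.
    by apply: eq_bigr => k _; rewrite PF.
  have -> : \bigcap_(k in `I_n) (F k @^-1` B k) `&` F n @^-1` V =
      \bigcap_(k in `I_n.+1) (F k @^-1` B' k).
    apply/seteqP; split=> w /=.
      move=> [Bw Vw] k /=; rewrite ltnS leq_eqVlt /B'; case: eqP => [->//|_ /= kn].
      exact: Bw.
    move=> Bw; split; last by have := Bw n (ltnSn n); rewrite /B' eqxx.
    by move=> k kn; have := Bw k (ltnW kn); rewrite /B' ltn_eqF.
  rewrite !pr// big_ord_recr/= /B' eqxx; congr (_ * _).
  by apply: eq_bigr => k _; rewrite ltn_eqF.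
Qed.

(** The joint law of [g] and [F n] is a product, so Tonelli's theorem integrates [F n] out. This
    plays the role of conditional expectation given the past. *)
Lemma past_integral n (g : Omega -> R) (phi : R * T -> \bar R) :
  (forall B, measurable B -> past n (g @^-1` B)) ->
  measurable_fun setT phi -> (forall z, 0 <= phi z) ->
  \int[P]_w phi (g w, F n w) = \int[P]_w \int[mu]_f phi (g w, f).
Proof.
move=> pg mphi phi0.
have mg : measurable_fun setT g.
  by move=> _ B mB; rewrite setTI; apply: past_measurable; exact: pg.
pose G : {mfun Omega >-> R} := HB.pack g (isMeasurableFun.Build _ _ _ _ g mg).
have mgF : measurable_fun setT (fun w => (g w, F n w)).
  by apply: measurable_fun_pair => //; exact: measurable_funP.
pose GF : {mfun Omega >-> (R * T)%type} :=
  HB.pack (fun w => (g w, F n w)) (isMeasurableFun.Build _ _ _ _ _ mgF).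
rewrite -[LHS](@ge0_integral_distribution _ _ _ _ _ P GF)//.
rewrite (@eq_measure_integral _ _ _ _ (distribution P G \x mu)); last first.
  move=> A mA _; symmetry; apply: product_measure_unique => // B C mB mC.
  rewrite -[LHS]/(P (g @^-1` B `&` F n @^-1` C)).
  by rewrite past_indep//; exact: pg.
rewrite fubini_tonelli1// ge0_integral_distribution//.
  exact: measurable_fun_fubini_tonelli_F.
by move=> y; exact: integral_ge0.
Qed.

End Independence.

(** * A conditional Borel-Cantelli lemma *)

Section ConditionalBorelCantelli.
Context {d d' : measure_display} {Omega : measurableType d}
  {T : measurableType d'} {R : realType} {P : probability Omega R}.
Context (F : nat -> {RV P >-> T}) (mu : probability T R).
Context (hdist : identically_distributed F mu) (hindep : mutually_independent F).
Local Open Scope ereal_scope.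

(** Whether a trial takes place at time [n] depends on the past only, and each trial succeeds with
    the same probability [mu V] given that past. *)
Lemma conditional_borel_cantelli (E : nat -> set Omega) (V : set T) :
  (forall n, past F n (E n)) -> measurable V -> 0 < mu V ->
  P.-negligible (lim_sup_set E `\`
                 lim_sup_set (fun n => E n `&` F n @^-1` V)).
Proof.
move=> pE mV muV0.
have mE n : measurable (E n) by exact: past_measurable (pE n).
have mFV k (B : set T) : measurable B -> measurable (F k @^-1` B).
  by move=> mB; exact: measurable_funPTI.
pose G N := lim_sup_set E `&` \bigcap_(n in [set n | (N <= n)%N]) ~` (E n `&` F n @^-1` V).
have mG N : measurable (G N).
  apply: measurableI.
    by apply: bigcapT_measurable => n; exact: bigcup_measurable.
  apply: bigcap_measurableType => n _; apply/measurableC/measurableI => //.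
  exact: mFV.
pose q := fine (mu (~` V)).
have qE : mu (~` V) = q%:E by rewrite fineK// fin_num_measure//; exact: measurableC.
have q0 : (0 <= q)%R by rewrite -lee_fin -qE.
have q1 : (q < 1)%R.
  have muVfin : mu V \is a fin_num by rewrite fin_num_measure.
  move: muV0 qE; rewrite probability_setC// -(fineK muVfin) lte_fin => V0 [<-].
  by rewrite ltrBlDr ltrDl.
(* [G N]: infinitely many trials, none of them successful from [N] on.  Splitting [C `&` G N]
   according to the first trial after [N], which fails, gains a factor [q]. *)
have claim i : forall N C, past F N C -> P (C `&` G N) <= (q ^+ i)%:E * P C.
  elim: i => [|i IH] N C pC.
    rewrite expr0 mul1e; apply: le_measure; rewrite ?inE//.
      by apply: measurableI => //; exact: past_measurable pC.
    exact: past_measurable pC.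
  pose D := seqDU (fun k => E (N + k)%N).
  pose CD k := C `&` D k.
  have pCD k : past F (N + k) (CD k).
    have pA m : past F m = @measurable _ (g_sigma_algebraType (cylinders F m)) by [].
    rewrite pA; apply: measurableI.
      by rewrite -pA; exact: (past_le (leq_addr _ _) pC).
    rewrite /D /seqDU; apply: measurableD; first exact: (pE (N + k)%N).
    apply: bigsetU_measurable => j _; rewrite -pA.
    by apply: (past_le _ (pE (N + j)%N)); rewrite leq_add2l ltnW.
  have mCD k : measurable (CD k) by exact: past_measurable (pCD k).
  pose A k := (CD k `&` F (N + k)%N @^-1` (~` V)) `&` G (N + k).+1.
  have pA' k : past F (N + k).+1 (CD k `&` F (N + k)%N @^-1` (~` V)).
    have pA m : past F m = @measurable _ (g_sigma_algebraType (cylinders F m)) by [].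
    rewrite pA; apply: measurableI; rewrite -pA.
      exact: (past_le (leqnSn _) (pCD k)).
    by apply: past_preimage => //; exact: measurableC.
  have mA k : measurable (A k).
    by apply: measurableI => //; exact: past_measurable (pA' k).
  have CGA : C `&` G N `<=` \bigcup_k A k.
    move=> w [Cw [Ew Gw]].
    have : (\bigcup_k E (N + k)%N) w.
      have [j /= Nj Ejw] := Ew N I.
      by exists (j - N)%N => //; rewrite subnKC.
    rewrite (seqDU_bigcup_eq (fun k => E (N + k)%N)) => -[k _ Dkw].
    exists k => //; split; last first.
      by split=> // n /= kn; apply: Gw => /=; rewrite (leq_trans _ (ltnW kn))// leq_addr.
    split=> // Vw; apply: (Gw (N + k)%N); first exact: leq_addr.
    by split=> //; exact: subset_seqDU Dkw.
  have tCD : trivIset setT CD by apply: trivIset_setIl; exact: trivIset_seqDU.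
  have sumP (B : nat -> set Omega) : (forall k, measurable (B k)) ->
        trivIset setT B -> P (\bigcup_k B k) = \sum_(k <oo) P (B k).
    move=> mB tB; rewrite measure_bigcup//.
    by apply: eq_eseriesl => k; rewrite in_setT.
  apply: (@le_trans _ _ (\sum_(k <oo) P (A k))).
    apply: measure_sigma_subadditive => //.
    by apply: measurableI => //; exact: past_measurable pC.
  apply: (@le_trans _ _ (\sum_(k <oo) (q ^+ i.+1)%:E * P (CD k))).
    apply: lee_nneseries => // k _.
    apply: (le_trans (IH _ _ (pA' k))).
    rewrite (past_indep hdist hindep)//; last exact: measurableC.
    by rewrite qE muleCA exprSr EFinM -muleA [P _ * _]muleC muleA.
  rewrite nneseriesZl//.
  rewrite -sumP// lee_wpmul2l ?lee_fin ?exprn_ge0//.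
  apply: le_measure; rewrite ?inE; first exact: bigcup_measurable.
    exact: past_measurable pC.
  by move=> w [k _ []].
have G0 N : P (G N) = 0.
  have PGfin : P (G N) \is a fin_num by rewrite fin_num_measure.
  have le i : (fine (P (G N)) <= q ^+ i)%R.
    rewrite -lee_fin fineK//.
    have := claim i N setT; rewrite setTI probability_setT mule1; apply.
    exact: (@measurableT _ (g_sigma_algebraType (cylinders F N))).
  apply/eqP; rewrite -(fineK PGfin) eqe eq_le; apply/andP; split; last first.
    by rewrite fine_ge0.
  have qi : GRing.exp q @ \oo --> (0%R : R) by apply: cvg_expr; rewrite ger0_norm.
  by apply: (cvgr_to_ge qi); exact: nearW.
have : P.-negligible (\bigcup_N G N).
  by apply: negligible_bigcup => N; apply/negligibleP; [exact: mG|exact: G0].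
apply: negligibleS => w [Ew nw].
have [N nN] : exists N, forall n, (N <= n)%N -> ~ (E n `&` F n @^-1` V) w.
  apply: contrapT => /forallNP H; apply: nw => N _.
  have /existsNP[n /not_implyP[Nn /contrapT EV]] := H N.
  by exists n.
by exists N => //; split=> // n /nN.
Qed.

End ConditionalBorelCantelli.

(** * The log-log Lyapunov function *)

Section DriftPointwise.
Context {R : realType}.
Implicit Types (u a b c D s t : R).

(** The truncation makes the function non-negative, and zero up to the number e. *)
Definition loglog (y : R) : R := ln (Num.max 1 (ln y)).

Lemma loglog_ge0 (y : R) : 0 <= loglog y.
Proof. by rewrite ln_ge0// le_max lexx. Qed.

Lemma measurable_loglog : measurable_fun setT loglog.
Proof.
apply: (measurableT_comp (@measurable_ln R)).
exact: measurable_maxr.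
Qed.

(* With [s = p ^ 2], this is [ln p <= p - 1]. *)
Lemma ln_le_quadratic s : 0 < s -> s <= 1 -> ln s <= (s - 1) - (s - 1) ^+ 2 / 4.
Proof.
move=> s0 s1; set v := ln s / 2; set p := expR v.
have sE : s = p ^+ 2.
  by rewrite -expRM_natr /v divfK// lnK.
have p0 : 0 <= p by exact: expR_ge0.
have p1 : p <= 1 by rewrite expR_le1 pmulr_lle0// ln_le0.
have := expR_ge1Dx v; rewrite -/p => vp.
have -> : ln s = 2 * v by rewrite /v mulrC divfK.
have : (s - 1) ^+ 2 <= 4 * (p - 1) ^+ 2.
  rewrite (_ : 4 * _ = (2 * (1 - p)) ^+ 2); last by ring.
  rewrite -sqrrN ler_sqr ?nnegrE ?mulr_ge0// ?opprB ?subr_ge0//; last by rewrite sE; nra.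
  rewrite sE; nra.
Qed.

Lemma ln_le_sub1 s : 0 < s -> ln s <= s - 1.
Proof. by move=> s0; rewrite -{1}(subrK 1 s) addrC le_ln1Dx// ltrBrDr addrC subrr. Qed.

(** From exp v >= v^2 / 2 at v = u / 2. Divided by [u] in the drift, this error has order u^-3,
    below the gain of order u^-2. *)
Lemma expR_Nhalf u : 0 < u -> expR (- (u / 2)) <= 8 / u ^+ 2.
Proof.
move=> u0; rewrite expRN -[8 / _]invf_div lef_pV2 ?posrE ?expR_gt0 ?divr_gt0 ?exprn_gt0//.
have := @expR_ge1Dxn R (u / 2) 1%N; rewrite divr_ge0 ?(ltW u0)// => /(_ isT).
apply: le_trans.
have -> : (u / 2) ^+ 2 / 2`!%:R = u ^+ 2 / 8 by rewrite (_ : 2`! = 2%N)//; field.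
lra.
Qed.

(** Factor out exp (u + a): the remaining factor 1 + exp (b - a - u) is at most exp (c + exp (- u /
    2)), since b - a <= u / 2 + c. The truncation at 1 is covered by u + a + c >= u / 2 >= 1. *)
Lemma max1_ln_le (A B u a b c D : R) : 2 <= u -> 0 <= A -> 0 <= B ->
  A <= expR a -> B <= expR b -> b - a <= D -> - a <= D ->
  D - u / 2 <= c -> 0 <= c ->
  Num.max 1 (ln (A * expR u + B)) <= u + a + (2 * c + 8 / u ^+ 2).
Proof.
move=> u2 A0 B0 Aa Bb baD aD Dc c0.
have u0 : 0 < u by exact: lt_le_trans u2.
have r0 : 0 <= 8 / u ^+ 2 by rewrite divr_ge0// sqr_ge0.
have e8 := expR_Nhalf u0.
have first_le : 1 <= u + a + (2 * c + 8 / u ^+ 2) by lra.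
rewrite ge_max first_le /=.
have [z|z] := eqVneq (A * expR u + B) 0.
  by rewrite z ln0// (le_trans _ first_le).
have z0 : 0 < A * expR u + B.
  by rewrite lt_neqAle eq_sym z addr_ge0// mulr_ge0// expR_ge0.
rewrite -(@expRK R (u + a + _)) ler_ln ?posrE ?expR_gt0//.
have le1 : A * expR u + B <= expR (u + a) * (1 + expR (b - a - u)).
  rewrite mulrDr mulr1 -expRD (_ : u + a + (b - a - u) = b); last by ring.
  by rewrite lerD// addrC expRD ler_wpM2r ?expR_ge0.
apply: (le_trans le1).
rewrite [expR (u + a + _)]expRD ler_wpM2l ?expR_ge0//.
apply: (@le_trans _ _ (expR c * (1 + expR (- (u / 2))))).
  rewrite mulrDr mulr1 lerD//.
    by rewrite -(expR0 R) ler_expR.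
  by rewrite -expRD ler_expR; lra.
apply: (@le_trans _ _ (expR c * expR (expR (- (u / 2))))).
  by rewrite ler_wpM2l ?expR_ge0 ?expR_ge1Dx.
by rewrite -expRD ler_expR; lra.
Qed.

(* [u = ln y]; [c] dominates the overshoot of [D = |a| + b] over [u / 2], and [g] is the gain
   from concavity on the event that the map contracts by a definite factor. *)
Lemma loglog_drift (A B u a b c D g eta : R) : 2 <= u -> 0 <= A -> 0 <= B ->
  A <= expR a -> B <= expR b -> b - a <= D -> - a <= D ->
  D - u / 2 <= c -> 0 <= c ->
  g = 0 \/ [/\ 0 < eta, a <= - eta, c = 0, 8 / u ^+ 2 <= eta / 2 &
               g = eta ^+ 2 / 16] ->
  loglog (A * expR u + B) <=
    ln u + (a + (2 * c + 8 / u ^+ 2)) / u - g / u ^+ 2.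
Proof.
move=> u2 A0 B0 Aa Bb baD aD Dc c0 hg.
have u0 : 0 < u by exact: lt_le_trans u2.
have := max1_ln_le u2 A0 B0 Aa Bb baD aD Dc c0.
rewrite /loglog; set w := Num.max _ _ => wle.
have w1 : 1 <= w by rewrite /w le_max lexx.
have w0 : 0 < w by exact: lt_le_trans w1.
have wu0 : 0 < w / u by rewrite divr_gt0.
have -> : ln w = ln u + ln (w / u).
  by rewrite -lnM ?posrE// mulrC divfK// gt_eqF.
rewrite -addrA lerD2l.
have wuE : w / u - 1 = (w - u) / u by field; rewrite gt_eqF.
have le1 : w / u - 1 <= (a + (2 * c + 8 / u ^+ 2)) / u.
  by rewrite wuE ler_pM2r ?invr_gt0//; lra.
case: hg => [->|[eta0 aeta cE e8 ->]].
  by rewrite mul0r subr0 (le_trans (ln_le_sub1 wu0)).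
(* On the contraction event [w / u - 1] is at most - eta / (2 u), and the quadratic term of
   [ln_le_quadratic] yields the gain eta^2 / (16 u^2). *)
have wu : w <= u - eta / 2 by move: wle; rewrite cE mulr0 add0r; lra.
have swu : w / u - 1 <= - (eta / (2 * u)).
  rewrite wuE invfM mulrA -mulNr ler_pM2r ?invr_gt0//; lra.
have eu0 : 0 < eta / (2 * u) by rewrite divr_gt0// mulr_gt0.
have s1 : w / u <= 1 by lra.
apply: (le_trans (ln_le_quadratic wu0 s1)); rewrite lerD// lerN2.
have -> : eta ^+ 2 / 16 / u ^+ 2 = (eta / (2 * u)) ^+ 2 / 4 by field; rewrite gt_eqF.
rewrite ler_pM2r ?invr_gt0//.
move: swu eu0; set x := w / u - 1; set y := eta / (2 * u) => xy y0; nra.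
Qed.

End DriftPointwise.

(** * Integrals used in the drift estimate *)

Section DriftIntegral.
Context {d : measure_display} {T : measurableType d} {R : realType}
  (mu : probability T R).
Implicit Types f g h : T -> R.
Local Open Scope ereal_scope.

Lemma integrable_indicM f (A : set T) : measurable A ->
  mu.-integrable setT (EFin \o f) ->
  mu.-integrable setT (fun x => (f x * \1_A x)%:E).
Proof.
move=> mA intf; apply: le_integrable (intf) => //.
  apply/measurable_EFinP/measurable_funM => //.
  by have /integrableP[/measurable_EFinP] := intf.
move=> x _; rewrite lee_fin normrM ler_piMr// indicE.
by case: (_ \in _); rewrite ?normr1 ?normr0.
Qed.

(** Shaped for the drift bound, which is affine in log A, in the tail of [D ^+ 2] and in the
    indicator of a contraction event. *)
Lemma integral_affine f g h (r s t u : R) :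
  mu.-integrable setT (EFin \o f) -> mu.-integrable setT (EFin \o g) ->
  mu.-integrable setT (EFin \o h) ->
  mu.-integrable setT (fun x => (r + s * f x + t * g x + u * h x)%:E) /\
  \int[mu]_x (r + s * f x + t * g x + u * h x)%:E =
  r%:E + s%:E * \int[mu]_x (f x)%:E + t%:E * \int[mu]_x (g x)%:E +
  u%:E * \int[mu]_x (h x)%:E.
Proof.
move=> intf intg inth.
have cstE (c : R) : \int[mu]_x cst c%:E x = c%:E.
  transitivity (c%:E * mu setT); first exact: integral_cst.
  by rewrite probability_setT mule1.
have intr : mu.-integrable setT (cst r%:E).
  by apply/integrableP; split=> //; rewrite (cstE `|r|%R) ltry.
have Z k (j : T -> R) : mu.-integrable setT (EFin \o j) ->
    mu.-integrable setT (fun x => k%:E * (j x)%:E) by move=> ?; exact: integrableZl.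
have D1 := integrableD measurableT intr (Z s _ intf).
have D2 := integrableD measurableT D1 (Z t _ intg).
have D3 := integrableD measurableT D2 (Z u _ inth).
split; first exact: D3.
transitivity (\int[mu]_x (cst r%:E x + s%:E * (f x)%:E + t%:E * (g x)%:E + u%:E * (h x)%:E)).
  by apply: eq_integral => x _.
rewrite (integralD measurableT D2 (Z u _ inth)) (integralD measurableT D1 (Z t _ intg)).
rewrite (integralD measurableT intr (Z s _ intf)) !integralZl//.
by rewrite cstE.
Qed.

(** Dominated convergence along integer thresholds, then monotonicity in the threshold for real
    ones. *)
Lemma tail_integral f g (e : R) : mu.-integrable setT (EFin \o f) ->
  measurable_fun setT g -> (forall x, 0 <= f x)%R -> (0 < e)%R ->
  exists n : nat, forall k : R, (n%:R <= k)%R ->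
    \int[mu]_x (f x * \1_[set x | (k < g x)%R] x)%:E <= e%:E.
Proof.
move=> intf mg f0 e0.
have mgk k : measurable [set x | (k < g x)%R].
  rewrite (_ : mkset _ = g @^-1` `]k, +oo[%classic); last first.
    by apply/seteqP; split=> x /=; rewrite in_itv/= andbT.
  by rewrite -(setTI (_ @^-1` _)); exact: mg.
have mf : measurable_fun setT f by have /integrableP[/measurable_EFinP] := intf.
have ml (A : set T) : measurable A -> measurable_fun setT (fun x => (f x * \1_A x)%:E).
  by move=> mA; apply/measurable_EFinP/measurable_funM.
pose F n x := (f x * \1_[set x | (n%:R < g x)%R] x)%:E.
have : \int[mu]_x F n x @[n --> \oo] --> \int[mu]_x 0.
  apply: (@dominated_cvg _ _ _ mu _ measurableT F (cst 0) (EFin \o f)) => //.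
  - by move=> n; exact: ml.
  - move=> x _; apply: cvg_near_cst; near=> n.
    rewrite /F indicE memNset ?mulr0//= => /lt_le_trans => /(_ (g x)).
    move/(_ (lexx _)); apply/negP; rewrite -leNgt.
    apply: le_trans (ltW (truncnS_gt (g x))) _; rewrite ler_nat.
    by near: n; exact: nbhs_infty_ge.
  - move=> n x _; rewrite gee0_abs ?lee_fin; last by rewrite mulr_ge0.
    by rewrite ler_piMr// indicE; case: (_ \in _).
rewrite integral0 => /fine_cvgP[Ffin] /cvgrPdist_le/(_ _ e0) Fe.
near \oo => n; exists n => k nk.
apply: (@le_trans _ _ (\int[mu]_x F n x)).
  apply: ge0_le_integral => //.
  - by move=> x _; rewrite lee_fin mulr_ge0.
  - exact: ml.
  - exact: ml.
  - move=> x _; rewrite lee_fin ler_wpM2l// !indicE.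
    have [kx|_] := boolP (x \in [set x | (k < g x)%R]); last by case: (_ \in _).
    by move: kx; rewrite !inE/= => kx; rewrite mem_set//=; exact: le_lt_trans kx.
have Fn : \int[mu]_x F n x \is a fin_num by near: n.
rewrite -(fineK Fn) lee_fin.
have : (`|0 - fine (\int[mu]_x F n x)| <= e)%R by near: n.
by rewrite sub0r normrN; apply: le_trans; exact: ler_norm.
Unshelve. all: by end_near.
Qed.

End DriftIntegral.

(** * The supermartingale inequality for log log *)

Section LogLogSupermartingale.
Context {d : measure_display} {T : measurableType d} {R : realType}
  (mu : probability T R) (A B : T -> R).
Context (mA : measurable_fun setT A) (mB : measurable_fun setT B).
Context (A_ge0 : forall x, 0 <= A x) (B_ge0 : forall x, 0 <= B x).
Let a x := ln (A x).
Let b x := log_plus `|B x|.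
(** A common bound for [- a] and [b - a], the two quantities that decide how far one step departs
    from a translation by [a] on the log scale. *)
Let D x := `|a x| + b x.
Let ma : measurable_fun setT a.
Proof. exact: measurableT_comp. Qed.
Let mb : measurable_fun setT b.
Proof.
apply: measurable_maxr => //; apply: measurableT_comp => //; exact: measurableT_comp.
Qed.
Let mD : measurable_fun setT D.
Proof. by apply: measurable_funD => //; exact: measurableT_comp. Qed.
Local Open Scope ereal_scope.

Let b_ge0 x : (0 <= b x)%R. Proof. by rewrite le_max lexx. Qed.

Let A_le x : (A x <= expR (a x))%R.
Proof.
have := A_ge0 x; rewrite le_eqVlt => /predU1P[<-|Ax]; first exact: expR_ge0.
by rewrite /a lnK.
Qed.

Let B_le x : (B x <= expR (b x))%R.
Proof.
have := B_ge0 x; rewrite le_eqVlt => /predU1P[<-|Bx]; first exact: expR_ge0.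
rewrite /b /log_plus gtr0_norm// -{1}(lnK Bx) ler_expR le_max.
by rewrite lexx orbT.
Qed.

Section Moments.
Context (eps : R) (eps0 : (0 < eps)%R).
Context (A2 : \int[mu]_x (`|a x| ^+ 2)%:E < +oo).
Context (B2 : \int[mu]_x (b x `^ (2 + eps))%:E < +oo).

Let ia2 : mu.-integrable setT (EFin \o (fun x => `|a x| ^+ 2)%R).
Proof.
apply/integrableP; split.
  by apply/measurable_EFinP/measurable_funX; exact: measurableT_comp.
under eq_integral do rewrite /= ger0_norm ?exprn_ge0//.
exact: A2.
Qed.

Let ib2 : mu.-integrable setT (EFin \o (fun x => b x `^ (2 + eps))%R).
Proof.
apply/integrableP; split.
  apply/measurable_EFinP.
  by apply: (measurableT_comp (measurable_powR _)).
under eq_integral do rewrite /= ger0_norm ?powR_ge0//.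
exact: B2.
Qed.

Lemma integrable_ln_lipschitz : mu.-integrable setT (EFin \o a).
Proof.
have [+ _] := integral_affine 1 1 0 0 ia2 ia2 ia2.
apply: le_integrable => //; first exact/measurable_EFinP.
move=> x _ /=; rewrite lee_fin [leRHS]ger0_norm; last first.
  by rewrite !mul0r !addr0 mul1r addr_ge0// exprn_ge0.
by rewrite !mul0r !addr0 mul1r; have := sqr_ge0 (`|a x| - 1)%R; nra.
Qed.

(** D^2 <= 2 a^2 + 2 b^2, and b^2 is at most 1 plus the power of order 2 + eps. *)
Lemma integrable_sqr_log : mu.-integrable setT (EFin \o (fun x => D x ^+ 2)%R).
Proof.
have [+ _] := integral_affine 2 2 2 0 ia2 ib2 ia2.
apply: le_integrable => //.
  by apply/measurable_EFinP/measurable_funX.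
move=> x _ /=; rewrite lee_fin !mul0r !addr0.
have bE : (b x ^+ 2 <= 1 + b x `^ (2 + eps))%R.
  have [b1|b1] := lerP (b x) 1.
    by rewrite (@le_trans _ _ 1%R) ?lerDl ?powR_ge0// expr_le1.
  rewrite -powR_mulrn// (le_trans (ler_powR (ltW b1) (_ : _ <= 2 + eps)%R))//.
    by rewrite lerDl ltW.
  by rewrite lerDr.
rewrite [leRHS]ger0_norm; last by rewrite !addr_ge0 ?mulr_ge0 ?powR_ge0 ?exprn_ge0.
rewrite [leLHS]ger0_norm ?sqr_ge0//.
by rewrite /D; have := sqr_ge0 (`|a x| - b x)%R; nra.
Qed.

End Moments.

Section Drift.
Context (A_gt0 : mu [set x | (0 < A x)%R] = 1) (A_lt1 : 0 < mu [set x | (A x < 1)%R]).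
Context (ia : mu.-integrable setT (EFin \o a)) (a0 : \int[mu]_x (a x)%:E = 0).
Context (iD : mu.-integrable setT (EFin \o (fun x => D x ^+ 2)%R)).

Let mlt (g : T -> R) (k : R) : measurable_fun setT g -> measurable [set x | (k < g x)%R].
Proof.
move=> mg; rewrite (_ : mkset _ = g @^-1` `]k, +oo[%classic); last first.
  by apply/seteqP; split=> x /=; rewrite in_itv/= andbT.
by rewrite -(setTI (_ @^-1` _)); exact: mg.
Qed.

Let mge (g : T -> R) (k : R) : measurable_fun setT g -> measurable [set x | (g x <= k)%R].
Proof.
move=> mg; rewrite (_ : mkset _ = ~` [set x | (k < g x)%R]).
  by apply: measurableC; exact: mlt.
by apply/seteqP; split=> x /=; rewrite leNgt => /negP.
Qed.

Let J (k : nat) := [set x | (a x <= - k.+1%:R^-1)%R] `&` [set x | (D x <= k%:R)%R].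

Let mJ k : measurable (J k). Proof. by apply: measurableI; exact: mge. Qed.

(** Up to a null set the countably many [J k] cover the event [A x < 1], which has positive mass. *)
Lemma strict_contraction_event : exists k : nat, 0 < mu (J k).
Proof.
apply: contrapT => /forallNP J0.
(* Where [A x = 0], the convention [ln 0 = 0] gives [a x = 0]; such points lie in no [J k] and are
   discarded as a null set. *)
have nA : mu (~` [set x | (0 < A x)%R]) = 0.
  by rewrite probability_setC ?A_gt0 ?subee//; exact: mlt.
have : mu.-negligible (\bigcup_k J k `|` ~` [set x | (0 < A x)%R]).
  apply: negligibleU.
    apply: negligible_bigcup => k; apply/negligibleP => //.
    apply/eqP; rewrite eq_le measure_ge0 andbT leNgt; apply/negP; exact: J0.
  apply/negligibleP; first by apply: measurableC; exact: mlt.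
  exact: nA.
move=> [N [mN N0 sN]]; move: A_lt1; apply/negP; rewrite -leNgt -N0.
apply: le_measure; rewrite ?inE//.
  rewrite (_ : mkset _ = ~` [set x | (1 <= A x)%R]); last first.
    by apply/seteqP; split=> x /=; rewrite ltNge => /negP.
  apply: measurableC; rewrite (_ : mkset _ = [set x | (- A x <= -1)%R]).
    by apply: mge; exact: measurableT_comp.
  by apply/seteqP; split=> x /=; rewrite lerN2.
move=> x /= Ax1; apply: sN; have [Ax0|] := pselect (0 < A x)%R; last by right.
left; have ax0 : (a x < 0)%R by rewrite /a ln_lt0// Ax0.
have na0 : (0 < - a x)%R by rewrite oppr_gt0.
pose k1 := Num.truncn (- a x)^-1%R; pose k2 := (Num.truncn (D x)).+1.
exists (maxn k1 k2) => //; split=> /=.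
  rewrite -lerN2 opprK invf_ple ?posrE// (le_trans (ltW (truncnS_gt _)))//.
  by rewrite ler_nat ltnS leq_maxl.
rewrite (le_trans (ltW (truncnS_gt _)))//.
by rewrite ler_nat leq_maxr.
Qed.

(** Integrate [loglog_drift]: the term linear in [a] has mean zero, which leaves a gain of order
    u^-2 against errors made no larger by taking u = ln y large. *)
Lemma loglog_supermartingale : exists2 y0 : R, (0 < y0)%R & forall y, (y0 <= y)%R ->
  \int[mu]_x (loglog (A x * y + B x))%:E <= (loglog y)%:E.
Proof.
have [k Jk] := strict_contraction_event.
pose eta : R := (k.+1%:R^-1)%R; have eta0 : (0 < eta)%R by rewrite invr_gt0.
pose q := fine (mu (J k)).
have qE : mu (J k) = q%:E by rewrite fineK// fin_num_measure.
have q0 : (0 < q)%R by rewrite -lte_fin -qE.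
(* The gain eta^2 q / 16 equals 8 e; the tail of [D ^+ 2] and the term 8 / u will each cost at most
   4 e. *)
pose e : R := (eta ^+ 2 * q / 128)%R.
have e0 : (0 < e)%R by rewrite divr_gt0// mulr_gt0// exprn_gt0.
have [n tail] := tail_integral iD mD (fun x => sqr_ge0 (D x)) e0.
(* The summands ensure in turn [2 <= u], the tail bound at [u / 2], [D <= u / 2] on [J k],
   [8 / u ^+ 2 <= eta / 2] and [8 / u <= 4 * e]. *)
pose u0 : R := (2 + 2 * n%:R + 2 * k%:R + 16 / eta + 2 / e)%R.
exists (expR u0); first exact: expR_gt0.
move=> y yu; have y0 : (0 < y)%R by exact: lt_le_trans (expR_gt0 _) yu.
pose u := ln y; have yE : y = expR u by rewrite /u lnK ?posrE.
have u0u : (u0 <= u)%R by rewrite -ler_expR -yE.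
have t0 : (0 <= n%:R :> R)%R := ler0n _ _.
have t1 : (0 <= k%:R :> R)%R := ler0n _ _.
have t2 : (0 < 16 / eta)%R by rewrite divr_gt0.
have t3 : (0 < 2 / e)%R by rewrite divr_gt0.
have u2 : (2 <= u)%R by move: u0u; rewrite /u0; lra.
have upos : (0 < u)%R by lra.
have nu : (n%:R <= u / 2)%R by move: u0u; rewrite /u0; lra.
have ku : (k%:R <= u / 2)%R by move: u0u; rewrite /u0; lra.
have eu : (8 / u ^+ 2 <= eta / 2)%R.
  have : (16 / eta <= u)%R by move: u0u; rewrite /u0; lra.
  rewrite ler_pdivrMr// => h.
  rewrite ler_pdivrMr ?exprn_gt0//; nra.
have ee : (8 / u <= 4 * e)%R.
  have : (2 / e <= u)%R by move: u0u; rewrite /u0; lra.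
  by rewrite !ler_pdivrMr//; lra.
pose Du := [set x | (u / 2 < D x)%R].
have mDu : measurable Du by exact: mlt.
have i1 := integrable_indicM mDu iD.
have i2 := integrable_indic mu (mJ k).
have [iR IR] := integral_affine (ln u + 8 / u ^+ 3)%R u^-1%R (4 / u ^+ 2)%R
  (- (eta ^+ 2 / 16 / u ^+ 2))%R ia i1 i2.
set rhs := (fun x : T => _%:E) in iR.
have le x : (loglog (A x * y + B x))%:E <= rhs x.
  rewrite lee_fin yE.
  (* Where D > u / 2, completing the square gives D - u / 2 <= D^2 / (2 u) <= c. Being quadratic in
     D and supported on a tail, [c] has mean o(1 / u). *)
  pose c : R := (2 / u * (D x ^+ 2 * \1_Du x))%R.
  pose g : R := (eta ^+ 2 / 16 * \1_(J k) x)%R.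
  have := @loglog_drift R (A x) (B x) u (a x) (b x) c (D x) g eta u2 (A_ge0 x) (B_ge0 x)
    (A_le x) (B_le x).
  have baD : (b x - a x <= D x)%R.
    by rewrite /D addrC lerD// -normrN ler_norm.
  have aD : (- a x <= D x)%R.
    by rewrite /D (le_trans (_ : _ <= `|a x|)%R) ?lerDl// -normrN ler_norm.
  have c0 : (0 <= c)%R.
    by rewrite /c mulr_ge0 ?divr_ge0 ?(ltW upos)// mulr_ge0 ?sqr_ge0.
  have Dc : (D x - u / 2 <= c)%R.
    rewrite /c indicE; have [|xn] := boolP (x \in Du); last first.
      rewrite mulr0 mulr0 subr_le0 leNgt; apply/negP => h.
      by move/negP: xn; apply; rewrite inE.
    rewrite inE /Du/= mulr1 => uD.
    by rewrite [leRHS]mulrAC ler_pdivlMr//; have := sqr_ge0 (D x - u)%R; nra.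
  move=> /(_ baD aD Dc c0) le.
  apply: (le_trans (le _)).
    have [xJ|xJ] := boolP (x \in J k); last first.
      by left; rewrite /g indicE (negbTE xJ) mulr0.
    right; split=> //; last by rewrite /g indicE xJ mulr1.
      by move: xJ; rewrite inE => -[].
    rewrite /c indicE memNset ?mulr0//= => uD.
    move: xJ; rewrite inE => -[_ /=]; apply/negP; rewrite -ltNge.
    exact: le_lt_trans uD.
  rewrite /g /c le_eqVlt; apply/orP; left; apply/eqP.
  by field; rewrite gt_eqF.
apply: (@le_trans _ _ (\int[mu]_x rhs x)).
  apply: ge0_le_integral => //.
  - by move=> x _; rewrite lee_fin loglog_ge0.
  - apply/measurable_EFinP; apply: (measurableT_comp measurable_loglog).
    by apply: measurable_funD => //; apply: measurable_funM.
  - by move/integrableP: iR => [].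
have Jint : \int[mu]_x (\1_(J k) x)%:E = q%:E.
  by rewrite integral_indic// setIT; exact: qE.
rewrite IR a0 mule0 adde0 Jint.
have tl := tail (u / 2)%R nu.
apply: (@le_trans _ _ ((ln u + 8 / u ^+ 3)%:E + (4 / u ^+ 2)%:E * e%:E +
    (- (eta ^+ 2 / 16 / u ^+ 2))%:E * q%:E)).
  by rewrite leeD2r// leeD2l// lee_wpmul2l// lee_fin divr_ge0// sqr_ge0.
rewrite -!EFinM -!EFinD lee_fin yE /loglog expRK max_r; last lra.
have -> : (ln u + 8 / u ^+ 3 + 4 / u ^+ 2 * e + - (eta ^+ 2 / 16 / u ^+ 2) * q =
   ln u + (8 / u + 4 * e - 8 * e) / u ^+ 2)%R by rewrite /e; field; rewrite gt_eqF.
rewrite gerDl ler_pdivrMr ?exprn_gt0// mul0r; lra.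
Qed.

End Drift.
End LogLogSupermartingale.

(** * Returns to bounded sets *)

Section LogLogMonotone.
Context {R : realType}.

Lemma le_loglog (s t : R) : 0 <= s -> s <= t -> loglog s <= loglog t.
Proof.
move=> s0 st; have [->|sn0] := eqVneq s 0.
  by rewrite {1}/loglog [ln 0]ln0// max_l// ln1 loglog_ge0.
have {sn0}s0 : 0 < s by rewrite lt_neqAle eq_sym sn0.
have t0 : 0 < t by exact: lt_le_trans st.
have max_gt0 (z : R) : 0 < Num.max 1 z by rewrite lt_max ltr01.
rewrite /loglog ler_ln ?posrE// ge_max !le_max lexx/=.
by rewrite ler_ln ?posrE// st orbT.
Qed.

Lemma loglog_expR_expR (K : R) : K <= loglog (expR (expR K)).
Proof.
rewrite /loglog expRK -{1}(expRK K) ler_ln ?posrE ?expR_gt0//.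
  by rewrite le_max lexx orbT.
Qed.

End LogLogMonotone.

Section Fatou.
Context {d : measure_display} {Omega : measurableType d} {R : realType}
  (P : probability Omega R).
Local Open Scope ereal_scope.

(** By Fatou's lemma the lower limit of [Z] has a finite integral, hence is finite almost
    everywhere. *)
Lemma negligible_cvg_pinfty (Z : nat -> Omega -> \bar R) (C : R) :
  (forall n, measurable_fun setT (Z n)) -> (forall n w, 0 <= Z n w) ->
  (forall n, \int[P]_w Z n w <= C%:E) ->
  P.-negligible [set w | Z n w @[n --> \oo] --> +oo].
Proof.
move=> mZ Z0 ZC.
have := fatou P measurableT mZ (fun n x _ => Z0 n x) => fat.
have limC : limn_einf (fun n => \int[P]_w Z n w) <= C%:E.
  rewrite limn_einf_lim; apply: lime_le; first exact: is_cvg_einfs.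
  by apply: nearW => n; apply: le_trans (ZC n); apply: ereal_inf_lbound; exists n => /=.
have ge0 w : 0 <= limn_einf (Z ^~ w).
  rewrite limn_einf_lim; apply: lime_ge; first exact: is_cvg_einfs.
  by apply: nearW => n; apply: le_ereal_inf_tmp => _ [m _ <-].
have intW : P.-integrable setT (fun w => limn_einf (Z ^~ w)).
  apply/integrableP; split.
    apply: measurableT_comp => //; apply: measurable_fun_limn_esup => n.
    exact: measurableT_comp.
  under eq_integral do rewrite gee0_abs//.
  by rewrite (le_lt_trans fat)// (le_lt_trans limC)// ltry.
have := integrable_ae measurableT intW.
apply: negligibleS => w /= Zw /(_ I).
by rewrite (cvg_limn_einf_sup Zw).1.
Qed.

End Fatou.

(** * Adaptedness and excursions of the dynamical system *)

Section SDS.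
Context {R : realType} {X : metricType R} (hX : proper_space X).
Context {d : measure_display} {Omega : measurableType d} {P : probability Omega R}.
Context (F : nat -> {RV P >-> selfmap X}).

Let pastT n : measurableType _ := g_sigma_algebraType (cylinders F n).

(** Induction on [n], with [measurable_eval] taken over the sigma-algebra [past F n.+1]. *)
Lemma past_sds (x : X) n (U : set X) : open U -> past F n (sds F x n @^-1` U).
Proof.
elim: n U => [|n IH] U oU.
  rewrite (_ : _ @^-1` _ = if `[< U x >] then setT else set0).
    by case: ifP => _; [exact: (@measurableT _ (pastT 0))|exact: (@measurable0 _ (pastT 0))].
  by apply/seteqP; split=> w /=; case: asboolP.
apply: (@measurable_eval _ _ hX _ (pastT n.+1) (F n) (sds F x n)) oU.
  by move=> _ B mB; rewrite setTI; exact: past_preimage.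
by move=> V oV; apply: (past_le (leqnSn n)); exact: IH.
Qed.

Lemma past_mdist_sds (x o : X) n (B : set R) : measurable B ->
  past F n ((fun w => mdist (sds F x n w) o) @^-1` B).
Proof.
move=> mB; suff : measurable_fun setT (fun w : pastT n => mdist (sds F x n w) o).
  by move=> /(_ measurableT _ mB); rewrite setTI.
apply: (measurability _ (RGenOInfty.measurableE R)) => // _ [_ [c ->] <-].
rewrite setTI.
rewrite (_ : _ @^-1` _ = sds F x n @^-1` [set y | c < mdist o y]).
  by apply: past_sds; exact: open_mdist_gt.
by apply/seteqP; split=> w /=; rewrite in_itv/= andbT metric_sym.
Qed.

Lemma measurable_sds (x : X) n (U : set X) : open U -> measurable (sds F x n @^-1` U).
Proof. by move=> oU; apply: (@past_measurable _ _ _ _ _ _ F n); exact: past_sds. Qed.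

Context (mu : probability (selfmap X) R).
Context (hdist : identically_distributed F mu) (hindep : mutually_independent F).
Context (hlip : forall n, {ae P, forall w, is_lipschitz (F n w)}).
Context (o : X).

Let A (f : selfmap X) := lipschitz_const f.
Let B (f : selfmap X) := mdist (f o) o.

Context (y0 : R) (y0_gt0 : 0 < y0).
Context (drift : forall y, y0 <= y ->
  (\int[mu]_f (loglog (A f * y + B f))%:E <= (loglog y)%:E)%E).

Local Open Scope ereal_scope.

Section Excursion.
Context (x : X) (N M : nat).

(* [alive k]: no return below [y0] between times [N] and [N + k].  As [0 < y0], the event is
   encoded in the single real variable [g k], which vanishes outside it. *)
Let dst n w := mdist (sds F x n w) o.
Let alive k := [set w | (dst N w <= M%:R)%R] `&`
  \bigcap_(j in [set j | (j <= k)%N]) [set w | (y0 <= dst (N + j) w)%R].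
Let g k w : R := (dst (N + k) w * \1_(alive k) w)%R.
Let Yge := [set y : R | (y0 <= y)%R].
(** The Lyapunov function killed below [y0], where no drift inequality is available; [phi] bounds
    its value after one more map. *)
Let psi (y : R) : R := (loglog y * \1_Yge y)%R.
Let phi (z : R * selfmap X) : R := (loglog (A z.2 * z.1 + B z.2) * \1_Yge z.1)%R.

Let mYge : measurable Yge.
Proof.
rewrite (_ : Yge = `[y0, +oo[%classic)//.
by apply/seteqP; split=> y /=; rewrite in_itv/= andbT.
Qed.

Let mYge_dst n : past F n [set w | (y0 <= dst n w)%R].
Proof. exact: past_mdist_sds mYge. Qed.

Let past_alive k : past F (N + k) (alive k).
Proof.
apply: (@measurableI _ (pastT (N + k))).
  apply: (past_le (leq_addr _ _)).
  have mI : measurable [set y : R | (y <= M%:R)%R].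
    rewrite (_ : mkset _ = `]-oo, M%:R]%classic)//.
  exact: past_mdist_sds mI.
apply: (@bigcap_measurableType _ (pastT (N + k))) => j /= jk.
by apply: (@past_le _ _ _ _ _ _ _ (N + j)); [rewrite leq_add2l|exact: mYge_dst].
Qed.

Let past_g k (C : set R) : measurable C -> past F (N + k) (g k @^-1` C).
Proof.
move=> mC; suff : measurable_fun setT (g k : pastT (N + k) -> R).
  by move=> /(_ measurableT _ mC); rewrite setTI.
apply: measurable_funM.
  by move=> _ E mE; rewrite setTI; exact: past_mdist_sds.
by apply: measurable_indic; exact: past_alive.
Qed.

Let mg k : measurable_fun setT (g k).
Proof. by move=> _ C mC; rewrite setTI; apply: (@past_measurable _ _ _ _ _ _ F (N + k)); exact: past_g. Qed.

Let mpsi : measurable_fun setT psi.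
Proof. by apply: measurable_funM => //; exact: measurable_loglog. Qed.

Let mphi : measurable_fun setT phi.
Proof.
apply: measurable_funM.
  apply: (measurableT_comp measurable_loglog).
  apply: measurable_funD.
    apply: measurable_funM => //.
    exact: (measurableT_comp (@measurable_lipschitz_const R X)).
  exact: (measurableT_comp (measurable_mdist_eval o o)).
by apply: measurableT_comp => //; exact: measurable_indic.
Qed.

Let psi_ge0 y : (0 <= psi y)%R.
Proof. by rewrite mulr_ge0 ?loglog_ge0. Qed.

Let phi_ge0 z : (0 <= phi z)%R.
Proof. by rewrite mulr_ge0 ?loglog_ge0. Qed.

Let psi_g k w : psi (g k w) = (loglog (dst (N + k) w) * \1_(alive k) w)%R.
Proof.
rewrite /psi /g; have [wa|wa] := pselect (alive k w).
  have -> : \1_(alive k) w = 1%R :> R by rewrite indicE mem_set.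
  rewrite !mulr1 indicE mem_set ?mulr1//.
  by case: wa => _ /(_ k (leqnn k)).
have -> : \1_(alive k) w = 0%R :> R by rewrite indicE memNset.
rewrite !mulr0 indicE memNset ?mulr0//=.
by move=> /(lt_le_trans y0_gt0); rewrite ltxx.
Qed.

Let mpsig k : measurable_fun setT (fun w => (psi (g k w))%:E).
Proof. by apply/measurable_EFinP; exact: measurableT_comp. Qed.

(** The killed process is a supermartingale: bound the next distance by A y + B, which holds almost
    surely, integrate the new map out by independence, and apply the drift. *)
Let excursion_step k :
  \int[P]_w (psi (g k.+1 w))%:E <= \int[P]_w (psi (g k w))%:E.
Proof.
apply: (@le_trans _ _ (\int[P]_w (phi (g k w, F (N + k)%N w))%:E)).
  apply: ae_ge0_le_integral => //.
  - by move=> w _; rewrite lee_fin.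
  - by move=> w _; rewrite lee_fin.
  - apply/measurable_EFinP; apply: (measurableT_comp mphi).
    by apply: measurable_fun_pair => //; exact: measurable_funP.
  have := hlip (N + k)%N; apply: filterS => w Fl _.
  rewrite lee_fin psi_g; have [wa|wa] := boolP (w \in alive k.+1); last first.
    by rewrite indicE (negbTE wa) mulr0.
  move: (wa); rewrite inE => -[wM wY].
  have wk : alive k w by split=> // j /= jk; apply: wY => /=; exact: leq_trans jk _.
  rewrite indicE wa mulr1 /phi /= /g indicE mem_set// mulr1.
  rewrite indicE mem_set ?mulr1; last exact: (wY k (leqnSn k)).
  apply: le_loglog; first exact: mdist_ge0.
  rewrite /dst addnS /= (le_trans (metric_triangle _ (F (N + k)%N w o) _))//.
  by rewrite lerD2r lipschitz_const_le.
rewrite (past_integral hdist hindep (@past_g k) (phi := fun z => (phi z)%:E))//; last first.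
  exact/measurable_EFinP.
apply: ge0_le_integral => //.
- by move=> w _; apply: integral_ge0 => f _; rewrite lee_fin.
- have mF := @measurable_fun_fubini_tonelli_F _ _ R (selfmap X) R mu (fun z => (phi z)%:E).
  apply: (measurableT_comp (mF _ _) (mg k)); first exact/measurable_EFinP.
  by move=> z; rewrite lee_fin.
move=> w _; rewrite /phi /psi /=; set y := g k w.
have [yY|yY] := boolP (y \in Yge); last first.
  rewrite indicE (negbTE yY) mulr0 integral0_eq// => f _.
  by rewrite mulr0.
rewrite indicE yY mulr1; under eq_integral do rewrite mulr1.
by apply: drift; move: yY; rewrite inE.
Qed.

(** The cutoff [M] bounds the initial mean, so all means of the killed process stay bounded; on this
    event that process would tend to infinity. *)
Lemma excursion_negligible : P.-negligible
  [set w | (dst N w <= M%:R)%R /\ (forall j, y0 <= dst (N + j) w)%R /\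
    forall r : R, \forall n \near \oo, (r <= dst n w)%R].
Proof.
pose Z k w := (psi (g k w))%:E.
have bound k : \int[P]_w Z k w <= (loglog M%:R)%:E.
  elim: k => [|k IH]; last exact: le_trans (excursion_step k) IH.
  have -> : (loglog M%:R)%:E = \int[P]_w cst (loglog (M%:R : R))%:E w.
    transitivity ((loglog (M%:R : R))%:E * P setT); last by rewrite -integral_cst.
    by rewrite probability_setT mule1.
  apply: ge0_le_integral => //; [by move=> w _; rewrite lee_fin|exact: mpsig|].
  move=> w _; rewrite lee_fin psi_g addn0 indicE.
  have [wa|_] := boolP (w \in alive 0); last by rewrite mulr0 loglog_ge0.
  rewrite mulr1 le_loglog ?mdist_ge0//.
  by move: wa; rewrite inE => -[].
have := @negligible_cvg_pinfty _ _ _ P Z (loglog M%:R) mpsig (fun n w => psi_ge0 _) bound.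
apply: negligibleS => w [wM [wY wr]] /=.
apply/cvgeyPge => K.
have [n0 _ Hn] := wr (expR (expR K)).
exists n0 => // k /= n0k; rewrite /Z lee_fin psi_g indicE mem_set ?mulr1; last first.
  by split=> // j _; exact: wY.
apply: (le_trans (loglog_expR_expR K)); apply: le_loglog; first exact: expR_ge0.
by apply: Hn => /=; exact: leq_trans n0k (leq_addl _ _).
Qed.

End Excursion.

(** If no ball is visited infinitely often, the distance tends to infinity, hence stays above [y0]
    from some time [N] on. Countably many pairs [N], [M] cover this event. *)
Lemma sds_no_escape (x : X) : P.-negligible
  (~` \bigcup_(r : nat) lim_sup_set (fun n => sds F x n @^-1` cball o r%:R)).
Proof.
pose G (N M : nat) := [set w | (mdist (sds F x N w) o <= M%:R)%R /\
  (forall j, y0 <= mdist (sds F x (N + j) w) o)%R /\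
    forall r : R, \forall n \near \oo, (r <= mdist (sds F x n w) o)%R].
have : P.-negligible (\bigcup_N \bigcup_M G N M).
  apply: negligible_bigcup => N; apply: negligible_bigcup => M.
  exact: excursion_negligible.
apply: negligibleS => w nw.
have far (r : R) : \forall n \near \oo, (r <= mdist (sds F x n w) o)%R.
  pose r' := (Num.truncn r).+1.
  have : ~ lim_sup_set (fun n => sds F x n @^-1` cball o r'%:R) w.
    by move=> h; apply: nw; exists r'.
  move=> /existsNP[N /not_implyP[_ hN]]; exists N => // n /= Nn.
  rewrite ltW// (lt_le_trans (truncnS_gt r))// leNgt; apply/negP => h.
  by apply: hN; exists n => //=; rewrite /cball/= metric_sym ltW.
have [N _ HN] := far y0.
exists N => //; exists (Num.truncn (mdist (sds F x N w) o)).+1 => //.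
split; first exact/ltW/truncnS_gt.
by split=> // j; apply: HN => /=; exact: leq_addr.
Qed.

End SDS.

(** * The limit set *)

Section Contraction.
Context {R : realType} {X : metricType R} (hX : proper_space X).
Context (f : X -> X) (k : R) (k0 : 0 <= k) (k1 : k < 1).
Context (fk : forall x y, mdist (f x) (f y) <= k * mdist x y).

Lemma iter_contraction n x y :
  mdist (iter n f x) (iter n f y) <= k ^+ n * mdist x y.
Proof.
elim: n => [|n IH]; first by rewrite expr0 mul1r.
by rewrite !iterS (le_trans (fk _ _))// exprS -mulrA ler_wpM2l.
Qed.

Lemma geometric_lt (c e : R) : 0 < e -> \forall n \near \oo, k ^+ n * c < e.
Proof.
move=> e0; have : GRing.exp k @ \oo --> (0 : R) by apply: cvg_expr; rewrite ger0_norm.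
have c0 : 0 < `|c| + 1 by rewrite ltr_wpDl.
move=> /cvgrPdist_lt/(_ (e / (`|c| + 1))).
rewrite divr_gt0// => /(_ isT); apply: filterS => n.
rewrite sub0r normrN ger0_norm ?exprn_ge0// ltr_pdivlMr//; apply: le_lt_trans.
by rewrite ler_wpM2l ?exprn_ge0// (le_trans (ler_norm _))// lerDl.
Qed.

(* A cluster point of the iterates of [o], which stay in the compact ball of radius [r]. *)
Lemma contraction_fixpoint (o : X) : exists x0, f x0 = x0.
Proof.
(* Solves d(o, f o) + k r = r, so that [f] maps the ball of radius [r] into itself. *)
pose r := mdist o (f o) / (1 - k).
have k1' : 0 < 1 - k by rewrite subr_gt0.
have fr x : mdist o x <= r -> mdist o (f x) <= r.
  move=> xr; rewrite (le_trans (metric_triangle _ (f o) _))//.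
  have : mdist o (f o) = r * (1 - k) by rewrite divfK// gt_eqF.
  by have := le_trans (fk o x) (ler_wpM2l k0 xr); lra.
pose x_ n := iter n f o.
have xr n : mdist o (x_ n) <= r.
  elim: n => [|n IH]; last exact: fr.
  by rewrite mdistxx divr_ge0 ?mdist_ge0// ltW.
have [|x0 [_ cx0]] := @hX o r (x_ @ \oo) _.
  by exists 0%N => // n _; exact: xr.
exists x0; apply: mdist_positivity; apply/eqP; rewrite eq_le mdist_ge0 andbT.
apply/ler_addgt0Pl => e e0; rewrite addr0.
have e4 : 0 < e / 4 by rewrite divr_gt0.
have [N _ HN] : \forall n \near \oo, k ^+ n * mdist o (f o) < e / 4.
  exact: geometric_lt.
have nb : nbhs x0 [set y | mdist x0 y < e / 4].
  by apply: open_nbhs_nbhs; split; [exact: open_mdist_lt|rewrite /= mdistxx].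
have ev : (x_ @ \oo) [set y | exists2 n, (N <= n)%N & y = x_ n].
  by exists N => // n /= Nn; exists n.
have [_ [[n Nn ->] /= xn]] := cx0 _ _ ev nb.
have small : mdist (x_ n) (f (x_ n)) < e / 4.
  rewrite (_ : f (x_ n) = iter n f (f o)); last by rewrite -iterS iterSr.
  exact: le_lt_trans (iter_contraction n o (f o)) (HN n Nn).
have := metric_triangle (f x0) (f (x_ n)) x0.
have := metric_triangle (f (x_ n)) (x_ n) x0.
rewrite (metric_sym (f (x_ n)) (x_ n)) (metric_sym (x_ n) x0).
have := fk x0 (x_ n); have : k * mdist x0 (x_ n) <= mdist x0 (x_ n).
  by rewrite ler_piMl ?mdist_ge0// ltW.
lra.
Qed.

End Contraction.

(** * Sets of positive mass meet the support *)

Section Support.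
Context {R : realType} {X : metricType R} (mu : probability (selfmap X) R).

(** Distinct maps are separated by their values at one point. Compact sets of maps are therefore
    closed, hence Borel. *)
Lemma selfmap_hausdorff : hausdorff_space (selfmap X).
Proof.
move=> f g fg; apply/continuousEP => x; apply: mdist_positivity.
apply/eqP; rewrite eq_le mdist_ge0 andbT leNgt; apply/negP => e0.
have e20 : 0 < mdist (f x) (g x) / 2 by rewrite divr_gt0.
have nb (h : selfmap X) :
    nbhs h [set j : selfmap X | mdist (h x) (j x) < mdist (f x) (g x) / 2].
  apply: open_nbhs_nbhs; split; last by rewrite /= mdistxx.
  exact: (open_eval x (open_mdist_lt (h x) _)).
have [h [/= fh gh]] := fg _ _ (nb f) (nb g).
have := metric_triangle (f x) (h x) (g x); rewrite (metric_sym (h x)); lra.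
Qed.

(** Inner regularity gives a compact subset of positive mass; if it missed the support, finitely
    many open null sets would cover it. *)
Lemma supp_meets (S : set (selfmap X)) : regular_measure mu ->
  measurable S -> (0 < mu S)%E -> exists2 f, S f & supp mu f.
Proof.
move=> hmu mS; rewrite (hmu S mS).2 => /ereal_sup_gt[_ [K [cK KS] <-] K0].
apply: contrapT => /forall2NP nS.
have null f : K f -> exists V : set (selfmap X), [/\ open V, V f & mu V = 0%E].
  move=> Kf; have [/(_ (KS _ Kf))//|nf] := nS f.
  move/existsNP: nf => [V /not_implyP[oV /not_implyP[Vf nV]]].
  exists V; split=> //; apply/eqP; rewrite eq_le measure_ge0 andbT leNgt.
  exact/negP.
pose V f := if pselect (K f) is left Kf then sval (cid (null f Kf)) else set0.
have Vo f : open (V f).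
  rewrite /V; case: pselect => [Kf|_]; last exact: open0.
  by case: cid => W /= [].
have V0 f : mu (V f) = 0%E.
  rewrite /V; case: pselect => [Kf|_]; last exact: measure0.
  by case: cid => W /= [].
have VK f : K f -> V f f.
  by move=> Kf; rewrite /V; case: pselect => // Kf'; case: cid => W /= [].
have : cover_compact K by rewrite -compact_cover.
move=> /(_ _ setT V (fun f _ => Vo f))[|D _ KD]; first by move=> f /VK; exists f.
have mK : measurable K.
  rewrite -(setCK K); apply: measurableC; apply: measurable_open_selfmap.
  by apply: closed_openC; apply: compact_closed cK; exact: selfmap_hausdorff.
have : mu.-negligible (\bigcup_(f in [set` D]) V f).
  rewrite bigcup_fset; apply: (big_ind (fun A => mu.-negligible A)).
  - exact: negligible_set0.
  - by move=> ? ?; exact: negligibleU.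
  - by move=> f _; apply/negligibleP; [exact: measurable_open_selfmap|exact: V0].
move=> /(negligibleS KD)/(negligibleP _ mK) => muK0.
by move: K0; rewrite muK0 ltxx.
Qed.

End Support.

(** * Passing infinitely many visits from one set to another *)

Section Visits.
Context {R : realType} {X : metricType R} (hX : proper_space X).
Context {d : measure_display} {Omega : measurableType d} {P : probability Omega R}.
Context (F : nat -> {RV P >-> selfmap X}) (mu : probability (selfmap X) R).
Context (hdist : identically_distributed F mu) (hindep : mutually_independent F).
Context (start : X).

Let visits (U : set X) := infinitely_often (sds F start) U.

(** Almost sure implication; with negligible sets it composes without any measurability of the two
    events. *)
Definition leads_to (U V : set X) := P.-negligible (visits U `\` visits V).

Lemma infinitely_oftenS (U V : set X) : U `<=` V -> visits U `<=` visits V.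
Proof. by move=> UV w io N /io[n Nn Un]; exists n => //; exact: UV. Qed.

Lemma leads_to_sub (U V : set X) : U `<=` V -> leads_to U V.
Proof.
move=> UV; apply: (@negligibleS _ _ _ _ set0); last exact: negligible_set0.
by move=> w [/(infinitely_oftenS UV)].
Qed.

Lemma leads_to_trans (U V W : set X) :
  leads_to U V -> leads_to V W -> leads_to U W.
Proof.
move=> UV VW; apply: negligibleS (negligibleU UV VW) => w [Uw nWw].
by have [Vw|nVw] := pselect (visits V w); [right|left].
Qed.

(** Maps within s' - s of [g] on the compact ball contain an open neighbourhood of [g], of positive
    mass as [g] is in the support. Conditional Borel-Cantelli then applies. *)
Lemma leads_to_step (g : selfmap X) (x y : X) (r s s' : R) : supp mu g ->
  (forall z, mdist x z <= r -> mdist y (g z) <= s) -> s < s' ->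
  leads_to (cball x r) (cball y s').
Proof.
move=> sg gxy ss'; have e0 : 0 < s' - s by rewrite subr_gt0.
have [V [oV Vg VP]] := open_selfmap_nbhs g (@hX x r) e0.
have pE n : past F n (sds F start n @^-1` cball x r).
  have mI : measurable [set t : R | t <= r].
    by rewrite (_ : mkset _ = `]-oo, r]%classic).
  rewrite (_ : _ @^-1` _ = (fun w => mdist (sds F start n w) x) @^-1` [set t | t <= r]).
    exact: past_mdist_sds.
  by apply/seteqP; split=> w; rewrite /cball/= metric_sym.
have := conditional_borel_cantelli hdist hindep pE (measurable_open_selfmap oV) (sg V oV Vg).
apply: negligibleS => w [xw nyw]; split=> // h; apply: nyw => N _.
have [n /= Nn [xn Vn]] := h N I.
(* [F n] carries the state at time [n] to the state at time [n.+1]. *)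
exists n.+1; first exact: leq_trans Nn _.
rewrite /cball/= (le_trans (metric_triangle _ (g (sds F start n w)) _))//.
have := gxy _ xn; have := VP _ Vn _ xn; lra.
Qed.

(* Each application of [f] shrinks the excess of the radius over [e / 2] by the factor [k]. *)
Lemma leads_to_fixpoint (f : selfmap X) (k : R) (x0 : X) (r e : R) :
  supp mu f -> 0 <= k -> k < 1 ->
  (forall x y, mdist (f x) (f y) <= k * mdist x y) -> f x0 = x0 -> 0 < e ->
  leads_to (cball x0 r) (cball x0 e).
Proof.
move=> sf k0 k1 fk fx0 e0; have e20 : 0 < e / 2 by rewrite divr_gt0.
have step m : leads_to (cball x0 r) (cball x0 (e / 2 + k ^+ m * (r - e / 2))).
  elim: m => [|m IH].
    by apply: leads_to_sub; rewrite expr0 mul1r addrC subrK.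
  apply: leads_to_trans IH _.
  apply: (@leads_to_step f _ _ _ (k * (e / 2 + k ^+ m * (r - e / 2)))) => //.
    by move=> z xz; rewrite -{1}fx0 (le_trans (fk _ _))// ler_wpM2l.
  (* With radii measured from e / 2, the room for perturbing [f] is (1 - k) e / 2 at every stage. *)
  rewrite exprS -subr_gt0.
  rewrite (_ : _ - _ = (1 - k) * (e / 2)); last by ring.
  by rewrite mulr_gt0// subr_gt0.
have [m _ Hm] : \forall n \near \oo, k ^+ n * (r - e / 2) < e / 2.
  exact: geometric_lt.
apply: leads_to_trans (step m) _; apply: leads_to_sub => z; rewrite /cball/=.
by have := Hm m (leqnn m) => /=; lra.
Qed.

End Visits.

(** * Orbits under the support and the limit set *)

Section Reachability.
Context {R : realType} {X : metricType R} (S : set (selfmap X)).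

(** Words are split at the map applied first, the order needed in [leads_to_reach]; [reach_rcons]
    adds a map at the other end, for invariance. *)
Inductive reach : X -> X -> Prop :=
| reach_refl x : reach x x
| reach_cons f x y : S f -> reach (f x) y -> reach x y.

Lemma reach_rcons f x y : S f -> reach x y -> reach x (f y).
Proof.
move=> Sf; elim => [z|g z t Sg _ IH]; first exact: reach_cons Sf (reach_refl _).
exact: reach_cons Sg IH.
Qed.

Lemma closure_reach_invariant x0 : invariant_closed S (closure (reach x0)).
Proof.
split; [|exact: closed_closure|].
  by exists x0; apply: subset_closure; exact: reach_refl.
move=> f Sf _ [y cy <-] B /(@cts_fun _ _ f y) /cy[z [rz Bz]].
by exists (f z); split=> //; exact: reach_rcons.
Qed.

Lemma closure_reach_smallest x0 (M : set X) : invariant_closed S M -> M x0 ->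
  closure (reach x0) `<=` M.
Proof.
move=> [_ cM SM] Mx0; rewrite (closure_id M).1//; apply: closure_subset => y.
move=> r; elim: r Mx0 => // f z t Sf _ IH Mz; apply: IH.
by apply: (SM f Sf); exists z.
Qed.

End Reachability.

Section Recurrence.
Context {R : realType} {X : metricType R} (hX : proper_space X).
Context {d : measure_display} {Omega : measurableType d} {P : probability Omega R}.
Context (F : nat -> {RV P >-> selfmap X}) (mu : probability (selfmap X) R).
Context (hdist : identically_distributed F mu) (hindep : mutually_independent F).

(** Induction along the word: continuity gives a ball mapped within half of the next radius, and the
    other half absorbs the perturbation of the map. *)
Lemma leads_to_reach (start x y : X) (U : set X) : reach (supp mu) x y ->
  open U -> U y -> exists2 e : R, 0 < e & leads_to F start (cball x e) U.
Proof.
move=> rxy oU Uy; elim: rxy Uy => [z Uz|f z t sf _ IH /IH[e e0 eU]].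
  have /open_mdistP/(_ _ Uz)[e e0 eU] := oU.
  exists (e / 2); first by rewrite divr_gt0.
  apply: leads_to_sub => t; rewrite /cball/= => zt; apply: eU.
  by rewrite (le_lt_trans zt)// ltr_pdivrMr// ltr_pMr// ltr1n.
have e20 : 0 < e / 2 by rewrite divr_gt0.
have [r r0 rP] := selfmap_mdist f z e20.
exists (r / 2); first by rewrite divr_gt0.
apply: leads_to_trans eU.
apply: (leads_to_step hX hdist hindep start sf (s := e / 2)).
  move=> u zu; apply/ltW/rP.
  by rewrite (le_lt_trans zu)// ltr_pdivrMr// ltr_pMr// ltr1n.
by rewrite ltr_pdivrMr// ltr_pMr// ltr1n.
Qed.

(** A ball around [o] lies in one around [x0], which leads to a small ball around [x0] and from
    there to [U]. Taking integer radii leaves countably many null sets. *)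
Lemma recurrent_of_no_escape (f : selfmap X) (k : R) (x0 o start : X) (U : set X) :
  supp mu f -> 0 <= k -> k < 1 ->
  (forall x y, mdist (f x) (f y) <= k * mdist x y) -> f x0 = x0 ->
  P.-negligible (~` \bigcup_(r : nat) infinitely_often (sds F start) (cball o r%:R)) ->
  open U -> U `&` closure (reach (supp mu) x0) !=set0 ->
  P (infinitely_often (sds F start) U) = 1%E.
Proof.
move=> sf k0 k1 fk fx0 esc oU [z [Uz /(_ U)]].
move=> /(_ (open_nbhs_nbhs (conj oU Uz)))[y [rxy Uy]].
have [e e0 eU] := leads_to_reach start rxy oU Uy.
have rU (r : nat) : leads_to F start (cball o r%:R) U.
  apply: leads_to_trans eU.
  apply: leads_to_trans (leads_to_fixpoint hX hdist hindep start
    (r%:R + mdist x0 o) sf k0 k1 fk fx0 e0).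
  apply: leads_to_sub => t; rewrite /cball/= => ot.
  by rewrite (le_trans (metric_triangle _ o _))// addrC lerD.
have mU : measurable (infinitely_often (sds F start) U).
  apply: bigcapT_measurable => n; apply: bigcup_measurable => m _.
  exact: measurable_sds.
have null : P.-negligible (~` infinitely_often (sds F start) U).
  apply: negligibleS (negligibleU esc (negligible_bigcup rU)) => w nU.
  have [[r _ rw]|nr] := pselect ((\bigcup_(r : nat)
    infinitely_often (sds F start) (cball o r%:R)) w); last by left.
  by right; exists r.
have null0 : P (~` infinitely_often (sds F start) U) = 0%E.
  by apply: measure_negligible null; exact: measurableC.
by rewrite -[X in P X]setCK probability_setC ?null0 ?sube0//; exact: measurableC.
Qed.

End Recurrence.

(** * Recurrence on the smallest closed invariant set *)

Theorem theorem6p7 (R : realType) (X : metricType R) (hX : proper_space X)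
    (d : measure_display) (Omega : measurableType d) (P : probability Omega R)
    (mu : probability (selfmap X) R) (hmu : regular_measure mu)
    (F : nat -> {RV P >-> selfmap X})
    (hdist : identically_distributed F mu)
    (hindep : mutually_independent F)
    (hlip : forall n, {ae P, forall w, is_lipschitz (F n w)})
    (o : X) :
  let A := fun (n : nat) (w : Omega) => lipschitz_const (F n w) in
  let B := fun (n : nat) (w : Omega) => mdist (F n w o) o in
  forall
    (hA_gt0 : forall n, P [set w | 0 < A n w] = 1%E)
    (hA_lt1 : forall n, (0 < P [set w | (A n w < 1)%R])%E)
    (hAB : forall n (y : R), (P [set w | (A n w * y + B n w)%R = y] < 1)%E)
    (hlogA : forall n, ('E_P[fun w => ln (A n w)] = 0)%E)
    (hlogA2 : forall n, ('E_P[fun w => (`|ln (A n w)| ^+ 2)%R] < +oo)%E)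
    (eps : R) (heps : 0 < eps)
    (hlogB : forall n,
      ('E_P[fun w => (log_plus `|B n w| `^ (2 + eps))%R] < +oo)%E),
  exists L : set X,
    [/\ smallest_invariant_closed (supp mu) L,
        topologically_recurrent F L &
        forall (x : X) (U : set X), open U -> U `&` L !=set0 ->
          P (infinitely_often (sds F x) U) = 1%E].
Proof.
move=> A B hA0 hA1 _ lnA lnA2 eps eps0 lnB.
pose At (f : selfmap X) := lipschitz_const f.
pose Bt (f : selfmap X) := mdist (f o) o.
have mAt : measurable_fun setT At := measurable_lipschitz_const.
have mBt : measurable_fun setT Bt := measurable_mdist_eval o o.
have At0 f : 0 <= At f := lipschitz_const_ge0 f.
have Bt0 f : 0 <= Bt f := mdist_ge0 _ _.
have mF : measurable_fun setT (F 0%N) by exact: measurable_funP.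
(* The hypotheses on the random maps pass to [mu] through the law of [F 0]. *)
have law (C : set (selfmap X)) : measurable C -> mu C = P (F 0%N @^-1` C).
  by move=> mC; rewrite -(hdist 0%N).
have lawI (g : selfmap X -> R) : measurable_fun setT g -> (forall f, 0 <= g f) ->
    (\int[mu]_f (g f)%:E = \int[P]_w (g (F 0%N w))%:E)%E.
  move=> mg g0; rewrite (@eq_measure_integral _ _ _ _ (distribution P (F 0%N))).
    by rewrite ge0_integral_distribution//; exact/measurable_EFinP.
  by move=> C mC _; exact: law.
have mlnA : measurable_fun setT (fun f => ln (At f)) by exact: measurableT_comp.
have mlnB : measurable_fun setT (fun f => log_plus `|Bt f|).
  by apply: measurable_maxr => //; apply: measurableT_comp => //; exact: measurableT_comp.
have A2P : (\int[P]_w (`|ln (At (F 0%N w))| ^+ 2)%:E < +oo)%E.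
  by have := lnA2 0%N; rewrite unlock.
have A2 : (\int[mu]_f (`|ln (At f)| ^+ 2)%:E < +oo)%E.
  rewrite (lawI (fun f => `|ln (At f)| ^+ 2))//.
  by apply: measurable_funX; exact: measurableT_comp.
have B2 : (\int[mu]_f (log_plus `|Bt f| `^ (2 + eps))%:E < +oo)%E.
  rewrite (lawI (fun f => log_plus `|Bt f| `^ (2 + eps))).
  - by have := lnB 0%N; rewrite unlock.
  - exact: (measurableT_comp (measurable_powR _)).
  - by move=> f; exact: powR_ge0.
have intA := integrable_ln_lipschitz mAt A2.
(* The logarithm may change sign, so the change of variables requires integrability, which the
   second moment supplies. *)
have EA : (\int[mu]_f (ln (At f))%:E = 0)%E.
  rewrite (@eq_measure_integral _ _ _ _ (distribution P (F 0%N))).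
    rewrite integral_distribution//; first by have := lnA 0%N; rewrite unlock.
      exact/measurable_EFinP.
    by apply: (integrable_ln_lipschitz (A := At \o F 0%N)) => //; exact: measurableT_comp.
  by move=> C mC _; exact: law.
have intD := integrable_sqr_log mAt mBt eps0 A2 B2.
have mAgt (c : R) : measurable [set f : selfmap X | c < At f].
  rewrite (_ : mkset _ = At @^-1` `]c, +oo[%classic).
    by rewrite -(setTI (_ @^-1` _)); exact: mAt.
  by apply/seteqP; split=> f /=; rewrite in_itv/= andbT.
have mAlt (c : R) : measurable [set f : selfmap X | At f < c].
  rewrite (_ : mkset _ = At @^-1` `]-oo, c[%classic).
    by rewrite -(setTI (_ @^-1` _)); exact: mAt.
  by apply/seteqP; split=> f.
have Agt0 : mu [set f : selfmap X | 0 < At f] = 1%E.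
  by rewrite law//; exact: (hA0 0%N).
have Alt1 : (0 < mu [set f : selfmap X | (At f < 1)%R])%E.
  by rewrite law//; exact: (hA1 0%N).
have [y0 y00 drift] := loglog_supermartingale mAt mBt At0 Bt0 Agt0 Alt1 intA EA intD.
have esc x := sds_no_escape hX hdist hindep hlip y00 drift x.
have mL := @measurable_is_lipschitz R X.
(* A value of [lipschitz_const] below 1 does not give a contraction by itself, as the default for
   non-Lipschitz maps is 0; the almost sure Lipschitz property is added. *)
have Lip0 : (0 < mu ([set f : selfmap X | is_lipschitz f] `&` [set f | (At f < 1)%R]))%E.
  rewrite lt_neqAle measure_ge0 andbT eq_sym; apply/negP => /eqP mu0.
  move: Alt1; rewrite law//; apply/negP; rewrite -leNgt.
  have : P.-negligible (F 0%N @^-1` [set f : selfmap X | (At f < 1)%R]).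
    have n0 : P.-negligible (F 0%N @^-1`
        ([set f : selfmap X | is_lipschitz f] `&` [set f | (At f < 1)%R])).
      apply/negligibleP; first by apply: measurable_funPTI; exact: measurableI.
      by rewrite -mu0 law//; exact: measurableI.
    apply: negligibleS (negligibleU n0 (hlip 0%N)) => w /= w1.
    by have [?|?] := pselect (is_lipschitz (F 0%N w)); [left|right].
  by move=> /measure_negligible -> //; apply: measurable_funPTI.
have [f [fl f1] sf] := supp_meets hmu (measurableI _ _ mL (mAlt 1)) Lip0.
have fk x y : mdist (f x) (f y) <= At f * mdist x y by exact: lipschitz_const_le.
have [x0 fx0] := contraction_fixpoint hX (At0 f) f1 fk o.
have rec (x : X) (U : set X) : open U -> U `&` closure (reach (supp mu) x0) !=set0 ->
    P (infinitely_often (sds F x) U) = 1%E.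
  exact: (recurrent_of_no_escape hX hdist hindep sf (At0 f) f1 fk fx0 (esc x)).
have invL := closure_reach_invariant (supp mu) x0.
exists (closure (reach (supp mu) x0)); split; last by [].
- split=> // M iM; apply: closure_reach_smallest => //.
  have [[m Mm] cM SM] := iM.
  (* The iterates of [f] at a point [m] of [M] stay in [M] and converge to [x0], so the open
     complement of [M] cannot contain [x0]. *)
  apply: contrapT => nM.
  have /open_mdistP/(_ _ nM)[e e0 eM] : open (~` M) by exact: closed_openC.
  have [n _ Hn] : \forall n \near \oo, At f ^+ n * mdist x0 m < e by exact: geometric_lt.
  have Mn j : M (iter j f m).
    by elim: j => [//|j IH]; apply: (SM f sf); exists (iter j f m).
  apply: (eM (iter n f m)) => //.
  rewrite -(iter_fix n fx0).
  exact: le_lt_trans (iter_contraction (At0 f) fk n x0 m) (Hn n (leqnn n)).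
- case: invL => [L0 cL _]; split=> // U x oU UL _; exact: rec.
Qed.
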